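(* Let $\frac12<\alpha<1$. (i) (Subcritical bifurcation.) For each integer $k\ge1$, there exist $\mu_k:=(\tanh(k)/k)^{1/2}$ and a local, analytic curve $$\varepsilon\mapsto(\varphi(\varepsilon),\mu(\varepsilon))\in C^\alpha_{\mathrm{even}}(\mathbb{S})\times(0,1)$$ of nontrivial $2\pi/k$-periodic Whitham solutions with $D_\varepsilon\varphi(0)=\cos(kx)$ that bifurcates from the trivial solution curve $\mu\mapsto(0,\mu)$ at $(\varphi(0),\mu(0))=(0,\mu_k)$. In a neighborhood of the bifurcation point $(0,\mu_k)$ these are all nontrivial solutions of $F_W(\varphi,\mu)=0$ in $C^\alpha_{\mathrm{even}}(\mathbb{S})\times(0,1)$, and there are no other bifurcation points $\mu>0$, $\mu\ne1$, for solutions in $C^\alpha_{\mathrm{even}}(\mathbb{S})$. (ii) (Transcritical bifurcation.) At $\mu=1$ the trivial solution curve $\mu\mapsto(0,\mu)$ intersects the curve $\mu\mapsto(\mu-1,\mu)$ of constant solutions $\varphi=\mu-1$; together these constitute all solutions in $C^\alpha_{\mathrm{even}}(\mathbb{S})$ in a neighborhood of $(\varphi,\mu)=(0,1)$.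
   Context: $\mathbb{S}$ is the unit circle; functions on $\mathbb{S}$ are identified with $2\pi$-periodic functions on $\mathbb{R}$. $C^\alpha_{\mathrm{even}}(\mathbb{S})$ is the Banach space of real-valued, even, $\alpha$-Hölder continuous functions on $\mathbb{S}$. The Whitham kernel $K\in L^1(\mathbb{R})$ is the inverse Fourier transform of $\xi\mapsto(\tanh(\xi)/\xi)^{1/2}$ (value $1$ at $\xi=0$), where the Fourier transform is $\int f(x)e^{-ix\xi}\,dx$. The operator $L_W f:=K*f$ acts on $f=\sum_{k\ge0}a_k\cos(kx)\in C^\alpha_{\mathrm{even}}(\mathbb{S})$ by $L_Wf=\sum_{k\ge 0}a_k(\tanh(k)/k)^{1/2}\cos(kx)$, the factor for $k=0$ being $1$. Set $F_W(\varphi,\mu):=\mu\varphi-L_W\varphi-\varphi^2$. A Whitham solution is a pair $(\varphi,\mu)$ with $F_W(\varphi,\mu)=0$; it is trivial if $\varphi=0$. A local curve is one defined for $\varepsilon$ in a neighborhood of $0$; its points are nontrivial for $\varepsilon\neq0$. A bifurcation point is a value $\mu>0$ such that every neighborhood of $(0,\mu)$ contains nontrivial solutions. *)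

(* Defs.v *)
From HB Require Import structures.
From mathcomp Require Import all_boot all_order all_algebra.
From mathcomp Require Import complex.
From mathcomp Require Import all_classical all_reals all_analysis.
From mathcomp Require Import lra.

Set Implicit Arguments.
Unset Strict Implicit.
Unset Printing Implicit Defensive.

Import Order.TTheory GRing.Theory Num.Theory.
Import numFieldNormedType.Exports.

Local Open Scope classical_set_scope.
Local Open Scope ring_scope.

Section HolderEven.
Context {R : realType} (alpha : R).

(* Functions on the circle are 2 pi-periodic functions on R, so the Hoelder
   quotients are taken with the distance of R; by periodicity their supremum
   is the same as for the arc length distance.  For alpha > 0 the existence of
   a bound on f follows from the Hoelder condition and periodicity. *)
Definition holder_bound (C : R) (f : R -> R) : Prop :=
  (forall x, `|f x| <= C) /\
  (forall x y, `|f x - f y| <= C * `|x - y| `^ alpha).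

Definition holder_even_pred : {pred R -> R} :=
  mem [set f : R -> R | [/\ forall x, f (- x) = f x,
                            periodic f (pi *+ 2)
                          & exists C, holder_bound C f]].

Record holder_even := HolderEven {
  holder_fun :> R -> R;
  _ : holder_fun \in holder_even_pred }.

HB.instance Definition _ := [isSub for holder_fun].
HB.instance Definition _ := [Choice of holder_even by <:].

Lemma holder_even_submod_closed : submod_closed holder_even_pred.
Proof.
split.
  rewrite inE; split => //; exists 0; split => [x|x y].
    by rewrite normr0.
  by rewrite subrr normr0 mul0r.
move=> a f g /[!inE] -[fe fp [C [fC fC']]] [ge gp [D [gD gD']]].
split => [x|x|]; rewrite ?fctE.
- by rewrite /GRing.scale/= fe ge.
- by rewrite /GRing.scale/= fp gp.
- exists (`|a| * C + D); split => [x|x y].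
    rewrite (le_trans (ler_normD _ _))// lerD//.
    by rewrite normrM ler_wpM2l.
  rewrite [X in `|X|](_ : _ = a * (f x - f y) + (g x - g y)); last first.
    by rewrite mulrBr opprD addrACA.
  rewrite (le_trans (ler_normD _ _))// mulrDl lerD// normrM -mulrA.
  by rewrite ler_wpM2l.
Qed.

HB.instance Definition _ := GRing.isSubmodClosed.Build _ _ holder_even_pred
  holder_even_submod_closed.
HB.instance Definition _ := [SubChoice_isSubLmodule of holder_even by <:].

Lemma holder_evenP (f : holder_even) :
  [/\ forall x, f (- x) = f x, periodic f (pi *+ 2)
    & exists C, holder_bound C f].
Proof. by case: f => f /= /[!inE]. Qed.

Lemma holder_even_ext (f g : holder_even) : f =1 g -> f = g.
Proof. by move=> fg; apply/val_inj/funext. Qed.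

(* The diagonal x = y only contributes 0 to the second supremum. *)
Definition holder_norm (f : holder_even) : R :=
  sup [set r : R | exists x : R, r = `|f x|] +
  sup [set r : R | exists x y : R, r = `|f x - f y| / `|x - y| `^ alpha].

Let supN (f : R -> R) := [set r : R | exists x : R, r = `|f x|].
Let supQ (f : R -> R) :=
  [set r : R | exists x y : R, r = `|f x - f y| / `|x - y| `^ alpha].

Let quot_le (f : R -> R) C x y : 0 <= C ->
  `|f x - f y| <= C * `|x - y| `^ alpha <->
  `|f x - f y| / `|x - y| `^ alpha <= C.
Proof.
move=> C0; have [->|xy] := eqVneq x y.
  by rewrite !subrr normr0 mul0r; split => // _; rewrite mulr_ge0 ?powR_ge0.
by rewrite ler_pdivrMr// powR_gt0// normr_gt0 subr_eq0.
Qed.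

Let supN_has (f : holder_even) : has_sup (supN f).
Proof.
have [_ _ [C [fC _]]] := holder_evenP f.
by split; [by exists (`|f 0 : R|); exists (0:R)|exists C => _ [x ->]].
Qed.

Let supQ_has (f : holder_even) : has_sup (supQ f).
Proof.
have [_ _ [C [fC fC']]] := holder_evenP f.
split; first by eexists; exists 0, 0.
by exists C => _ [x [y ->]]; apply/quot_le => //; exact: le_trans (fC 0).
Qed.

Let supN_ub (f : holder_even) x : `|f x| <= sup (supN f).
Proof. by apply: sup_upper_bound; [exact: supN_has|exists x]. Qed.

Let supQ_ub (f : holder_even) x y :
  `|f x - f y| / `|x - y| `^ alpha <= sup (supQ f).
Proof. by apply: sup_upper_bound; [exact: supQ_has|exists x, y]. Qed.

Let supN_ge0 (f : holder_even) : 0 <= sup (supN f).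
Proof. exact: le_trans (supN_ub f 0). Qed.

Let supQ_ge0 (f : holder_even) : 0 <= sup (supQ f).
Proof. by apply: le_trans (supQ_ub f 0 0); rewrite divr_ge0// powR_ge0. Qed.

Lemma holder_norm_ub (f : holder_even) x : `|f x| <= holder_norm f.
Proof. by rewrite (le_trans (supN_ub f x))// lerDl; exact: supQ_ge0. Qed.

Lemma holder_normP (f : holder_even) C D :
  (forall x, `|f x| <= C) ->
  (forall x y, `|f x - f y| <= D * `|x - y| `^ alpha) -> 0 <= D ->
  holder_norm f <= C + D.
Proof.
move=> fC fD D0; apply: lerD.
  by apply: ge_sup => [|_ [x ->]//]; have [] := supN_has f.
apply: ge_sup => [|_ [x [y ->]]]; first by have [] := supQ_has f.
exact/quot_le.
Qed.

Let supQ_lip (f : holder_even) x y :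
  `|f x - f y| <= sup (supQ f) * `|x - y| `^ alpha.
Proof. by apply/quot_le; [exact: supQ_ge0|exact: supQ_ub]. Qed.

Lemma holder_norm_lip (f : holder_even) x y :
  `|f x - f y| <= holder_norm f * `|x - y| `^ alpha.
Proof.
by rewrite (le_trans (supQ_lip f x y))// ler_wpM2r ?powR_ge0// lerDr; exact: supN_ge0.
Qed.

Let ler_holder_normD (f g : holder_even) :
  holder_norm (f + g) <= holder_norm f + holder_norm g.
Proof.
rewrite [leRHS]addrACA; apply: holder_normP => [x|x y|].
- by rewrite (le_trans (ler_normD _ _))// lerD//; exact: supN_ub.
- rewrite [X in `|X|](_ : _ = (f x - f y) + (g x - g y)); last first.
    by rewrite /= opprD addrACA.
  rewrite (le_trans (ler_normD _ _))// mulrDl.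
  by rewrite lerD//; exact: supQ_lip.
- by rewrite addr_ge0//; exact: supQ_ge0.
Qed.

Let holder_normZ_le (l : R) (f : holder_even) :
  holder_norm (l *: f) <= `|l| * holder_norm f.
Proof.
rewrite mulrDr; apply: holder_normP => [x|x y|].
- by rewrite normrM ler_wpM2l//; exact: supN_ub.
- rewrite /= -mulrBr normrM -mulrA ler_wpM2l//; exact: supQ_lip.
- by rewrite mulr_ge0//; exact: supQ_ge0.
Qed.

Let holder_normZ (l : R) (f : holder_even) :
  holder_norm (l *: f) = `|l| * holder_norm f.
Proof.
apply/eqP; rewrite eq_le holder_normZ_le andTb.
have [->|l0] := eqVneq l 0.
  by rewrite normr0 mul0r; rewrite addr_ge0//; [exact: supN_ge0|exact: supQ_ge0].
have := holder_normZ_le l^-1 (l *: f).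
by rewrite scalerA mulVf// scale1r normfV ler_pdivlMl// normr_gt0.
Qed.

Let holder_norm0_eq0 (f : holder_even) : holder_norm f = 0 -> f = 0.
Proof.
move=> f0; apply: holder_even_ext => x; apply/eqP.
by rewrite -normr_le0 -f0 holder_norm_ub.
Qed.

HB.instance Definition _ := @Lmodule_isNormed.Build R holder_even
  holder_norm ler_holder_normD holder_normZ holder_norm0_eq0.

Lemma holder_normE (f : holder_even) : `|f| = holder_norm f.
Proof. by []. Qed.

Lemma holder_dist_ub (f g : holder_even) x : `|f x - g x| <= `|f - g|.
Proof. exact: (holder_norm_ub (f - g) x). Qed.

Lemma cst_holder_even (c : R) : cst c \in holder_even_pred.
Proof.
rewrite inE; split => //; exists `|c|; split => [//|x y].
by rewrite subrr normr0 mulr_ge0// powR_ge0.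
Qed.

Definition holder_cst (c : R) : holder_even := HolderEven (cst_holder_even c).

Lemma holder_even_cauchy_cvg (F : set_system holder_even) :
  ProperFilter F -> cauchy F -> cvg F.
Proof.
move=> FF /cauchyP Fc.
have {}Fc e : 0 < e -> exists f : holder_even, F [set g | `|f - g| < e].
  by move=> e0; have [f] := Fc _ e0; rewrite -ball_normE => Ff; exists f.
have evc (x : R) : cvg ((fun f : holder_even => f x) @ F).
  apply/cauchy_cvgP/cauchy_exP => e e0; have [f Ff] := Fc _ e0.
  exists (f x); suff : F [set g | ball (f x) e (g x)] by [].
  apply: filterS Ff => g /= fg; rewrite -ball_normE.
  exact: (le_lt_trans (holder_dist_ub f g x) fg).
pose h x := lim ((fun f : holder_even => f x) @ F).
have hc x : (fun f : holder_even => f x) @ F --> h x by exact: evc.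
have lim_le (u : holder_even -> R) l C : u @ F --> l ->
    F [set f | `|u f| <= C] -> `|l| <= C.
  move=> ul uC; rewrite leNgt; apply/negP => Cl.
  have /cvgrPdist_lt/(_ (`|l| - C)) := ul; rewrite subr_gt0 => /(_ Cl) ul'.
  have [f [/= f1 f2]] := filter_ex (filterI uC ul').
  move: f2; rewrite ltNge => /negP; apply.
  by rewrite (le_trans _ (lerB_dist _ _))// lerB.
have hN (f : holder_even) e x : F [set g | `|f - g| < e] -> `|f x - h x| <= e.
  move=> Ff; apply: (lim_le (fun g : holder_even => f x - g x)).
    by apply: cvgB; [exact: cvg_cst|exact: hc].
  apply: filterS Ff => g /= /ltW fg.
  exact: (le_trans (holder_dist_ub f g x) fg).
have hL (f : holder_even) e x y : F [set g | `|f - g| < e] ->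
    `|(f x - h x) - (f y - h y)| <= e * `|x - y| `^ alpha.
  move=> Ff.
  apply: (lim_le (fun g : holder_even => (f x - g x) - (f y - g y))).
    by do 2 apply: cvgB; try exact: cvg_cst; exact: hc.
  apply: filterS Ff => g /= /ltW fg.
  apply: le_trans (holder_norm_lip (f - g) x y) _.
  by rewrite ler_wpM2r// powR_ge0.
have hP : h \in holder_even_pred.
  rewrite inE; split.
  - move=> x; rewrite /h; congr (lim (_ @ F)); apply/funext => f.
    by have [-> _ _] := holder_evenP f.
  - move=> x; rewrite /h; congr (lim (_ @ F)); apply/funext => f.
    by have [_ -> _] := holder_evenP f.
  - have [f Ff] := Fc _ ltr01.
    exists (1 + holder_norm f); split => [x|x y].
      rewrite -[h x](subrK (f x)) (le_trans (ler_normD _ _))// lerD//.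
        by rewrite distrC hN.
      exact: holder_norm_ub.
    rewrite [X in `|X|](_ : _ = - ((f x - h x) - (f y - h y)) + (f x - f y)).
      rewrite (le_trans (ler_normD _ _))// mulrDl lerD//.
        by rewrite normrN; exact: hL.
      exact: holder_norm_lip.
    rewrite !opprB [f y - h y]addrC addrACA; lra.
apply/cvg_ex; exists (HolderEven hP : holder_even).
apply/cvgrPdist_lt => e e0.
have e40 : 0 < e / 4 by rewrite divr_gt0.
have [f Ff] := Fc _ e40; apply: filterS (Ff) => g /= fg.
rewrite -[X in `|X|](subrKA f) (le_lt_trans (ler_normD _ _))//.
have fH : `|f - HolderEven hP| <= e / 4 + e / 4.
  apply: holder_normP => [x|x y|]; [exact: hN|exact: hL|exact: ltW].
rewrite distrC; move: fH fg; lra.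
Qed.

HB.instance Definition _ :=
  Uniform_isComplete.Build holder_even holder_even_cauchy_cvg.

End HolderEven.
Arguments holder_even {R} alpha.
Arguments holder_cst {R} alpha c.

Section RealAnalytic.
Context {R : realType} {V : normedModType R}.

Definition real_analytic_at (f : R -> V) (a : R) : Prop :=
  exists c : nat -> V, \forall e \near a,
    series (fun n => (e - a) ^+ n *: c n) @ \oo --> f e.

Definition real_analytic_on (D : set R) (f : R -> V) : Prop :=
  forall a, D a -> real_analytic_at f a.

End RealAnalytic.

Section Whitham.
Context {R : realType}.
Notation leb := (@lebesgue_measure R).

Definition tanh (x : R) : R :=
  (expR x - expR (- x)) / (expR x + expR (- x)).

Definition whitham_symbol (xi : R) : R :=
  if xi == 0 then 1 else Num.sqrt (tanh xi / xi).

(* \int f(x) e^(-i x xi) dx, for f real-valued and integrable. *)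
Definition fourier_transform (f : R -> R) (xi : R) : R[i] :=
  Complex (\int[leb]_(x in setT) (f x * cos (x * xi)))
          (- \int[leb]_(x in setT) (f x * sin (x * xi))).

(* The symbol is not integrable, so "K is its inverse Fourier transform" means
   that K is the integrable function whose transform is the symbol; this
   determines K up to a null set, hence determines K * f. *)
Definition is_whitham_kernel (K : R -> R) : Prop :=
  leb.-integrable setT (EFin \o K) /\
  forall xi, fourier_transform K xi = Complex (whitham_symbol xi) 0.

Definition convolution (f g : R -> R) (x : R) : R :=
  \int[leb]_(y in setT) (f y * g (x - y)).

Definition whitham_F (K phi : R -> R) (mu : R) : R -> R :=
  fun x => mu * phi x - convolution K phi x - phi x ^+ 2.

Definition whitham_solution (K phi : R -> R) (mu : R) : Prop :=
  forall x, whitham_F K phi mu x = 0.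

Definition bifurcation_point (K : R -> R) (alpha mu : R) : Prop :=
  0 < mu /\
  forall U : set (holder_even alpha * R), nbhs (0 : holder_even alpha, mu) U ->
    exists phi nu, [/\ U (phi, nu), whitham_solution K phi nu & phi != 0].

Definition whitham_speed (k : nat) : R := Num.sqrt (tanh k%:R / k%:R).

End Whitham.

(* Main.v *)
Require Import Defs.
From HB Require Import structures.
From mathcomp Require Import all_boot all_order all_algebra.
From mathcomp Require Import all_classical all_reals measurable_realfun all_analysis.
From mathcomp Require Import ring lra.

Set Implicit Arguments.
Unset Strict Implicit.
Unset Printing Implicit Defensive.

Import Order.TTheory GRing.Theory Num.Theory.
Import numFieldNormedType.Exports.

Local Open Scope classical_set_scope.
Local Open Scope ring_scope.

(** The speeds [mu > 0] at which [mu - L] fails to be invertible, [L] being the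
    convolution by [K], are the values [m n] of the symbol at the integers. These
    are pairwise distinct ([symbol_decr]) and accumulate only at [0], so that at
    [mu = m k] the kernel of [m k - L] is the line of [cos (k x)], and near any
    other [mu > 0] the equation [mu phi - L phi = phi ^ 2] has only the small
    solution [0] ([nonresonant_trivial]).

    Linear part. Even trigonometric polynomials are uniformly dense
    ([cospan_dense], by Bernstein approximation in [cos x]), so an operator
    bounded in supremum norm is determined by its values on cosines ([cos_ext],
    [multiplier_ext]). This is how [L] is seen to preserve evenness and how all
    operator identities are proved. The inverse of [mu - L] off its kernel is
    built explicitly ([multiplier_resolvent]): six terms of the Neumann series in
    [L / mu] leave a remainder with multipliers [O(m n ^ 6) = O(n ^ -3)], which is
    an absolutely convergent series of rank one operators on the Hoelder space.

    Nonlinear part. Let [S] be that inverse, extended by [0] on the kernel, and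
    [p] the coefficient of [c = cos (k x)]. Writing [phi = e w] with [p w = 1],
    the two components of the equation become [mu = m k + e p (w ^ 2)] and
<<
      w = c + e (S (w ^ 2) - p (w ^ 2) S w)
>>
    ([reduction_sound], [reduction_complete]). The right-hand side is a cubic
    polynomial map of the Banach algebra, so comparing powers of [e] gives a
    recursion for the coefficients of [w], and the majorant
    [M r ^ n / (n + 1) ^ 2] makes the series converge ([fixpoint_sumE]).
    Convergent power series in a Banach space can be recentred
    ([power_series_analytic]), whence analyticity at every point of a ball.

    Completeness of the branch. A small solution satisfies
    [|phi| <= 2 |c| |p phi|] ([small_solution_mode]); so if it is nonzero then
    [e = p phi] is nonzero, [phi / e] lies in a fixed ball, and it solves the
    fixed point equation, whose solution in that ball is unique for small [e]
    ([branch_complete]). For [k = 0], that is [mu = 1], the constant [w = 1]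
    solves the fixed point equation for all [e], and the branch consists of the
    constants [mu - 1] ([constant_complete]). *)

(** * The Hoelder algebra and its cosines *)

Section HolderAlgebra.
Context {R : realType} {alpha : R}.
Notation X := (holder_even alpha).

Lemma holderDE (f g : X) x : (f + g) x = f x + g x. Proof. by []. Qed.
Lemma holderBE (f g : X) x : (f - g) x = f x - g x. Proof. by []. Qed.
Lemma holderZE a (f : X) x : (a *: f) x = a * f x. Proof. by []. Qed.

Lemma holder_mul_subproof (f g : X) : (fun x => f x * g x) \in holder_even_pred alpha.
Proof.
have [fe fp _] := holder_evenP f; have [ge gp _] := holder_evenP g.
rewrite inE; split => [x|x|]; rewrite ?fe ?ge ?fp ?gp//.
exists (`|f| * `|g| + `|f| * `|g|); split => [x|x y].
  rewrite normrM (@le_trans _ _ (`|f| * `|g|)) ?lerDl ?mulr_ge0//.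
  by rewrite ler_pM// holder_norm_ub.
rewrite (_ : _ - _ = f x * (g x - g y) + g y * (f x - f y)); last by ring.
rewrite (le_trans (ler_normD _ _))// mulrDl lerD// normrM.
  by rewrite -mulrA ler_pM// ?holder_norm_ub ?holder_norm_lip.
by rewrite (mulrC `|f|) -mulrA ler_pM// ?holder_norm_ub ?holder_norm_lip.
Qed.

Definition hmul (f g : X) : X := HolderEven (holder_mul_subproof f g).

Lemma hmulE (f g : X) x : hmul f g x = f x * g x. Proof. by []. Qed.


Lemma holder_norm_ubX (f : X) C D : 0 <= D -> (forall x, `|f x| <= C) ->
  (forall x y, `|f x - f y| <= D * `|x - y| `^ alpha) -> `|f| <= C + D.
Proof. by move=> D0 fC fD; rewrite holder_normE holder_normP. Qed.

Lemma hmul_norm (f g : X) : `|hmul f g| <= 3 * (`|f| * `|g|).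
Proof.
rewrite (_ : 3 * _ = `|f| * `|g| + (`|f| * `|g| + `|f| * `|g|)); last by ring.
apply: holder_norm_ubX => [|x|x y]; first by rewrite addr_ge0// mulr_ge0.
  by rewrite hmulE normrM ler_pM// holder_norm_ub.
rewrite !hmulE.
rewrite (_ : _ - _ = f x * (g x - g y) + g y * (f x - f y)); last by ring.
rewrite (le_trans (ler_normD _ _))// mulrDl lerD// normrM.
  by rewrite -mulrA ler_pM// ?holder_norm_ub ?holder_norm_lip.
by rewrite (mulrC `|f|) -mulrA ler_pM// ?holder_norm_ub ?holder_norm_lip.
Qed.

Lemma hmulC (f g : X) : hmul f g = hmul g f.
Proof. by apply: holder_even_ext => x; rewrite !hmulE mulrC. Qed.

Lemma hmulDl (f g h : X) : hmul (f + g) h = hmul f h + hmul g h.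
Proof.
by apply: holder_even_ext => x; rewrite holderDE !hmulE holderDE mulrDl.
Qed.

Lemma hmulZl a (f g : X) : hmul (a *: f) g = a *: hmul f g.
Proof.
by apply: holder_even_ext => x; rewrite holderZE !hmulE holderZE mulrA.
Qed.

Hypothesis alpha01 : 0 < alpha < 1.

Lemma cos_lip (x y : R) : `|cos x - cos y| <= `|x - y|.
Proof.
wlog xy : x y / x < y.
  move=> H; have [xy|yx|->] := ltgtP x y; first exact: H.
    by rewrite distrC (distrC x); exact: H.
  by rewrite !subrr normr0.
have [z _] := @MVT R (@cos R) (fun x => - sin x) x y xy
  (fun z _ => is_derive_cos z) (continuous_subspaceT (@continuous_cos R)).
rewrite distrC => ->; rewrite normrM normrN (distrC x) ler_piMl//.
by rewrite ler_norml sin_geN1 sin_le1.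
Qed.

(** The Lipschitz bound serves at small distances, the trivial bound [2] at
    large ones. *)
Lemma powR_dist_lip (d n : R) : 0 <= d -> 0 <= n -> Num.min 2 (n * d) <= (2 + n) * d `^ alpha.
Proof.
move=> d0 n0; have /andP[a0 a1] := alpha01.
have [->|dn0] := eqVneq d 0.
  by rewrite powR0 ?gt_eqF// !mulr0; rewrite ge_min lexx orbT.
have {}d0 : 0 < d by rewrite lt_def dn0.
have [d1|d1] := leP d 1.
  rewrite ge_min; apply/orP; right; rewrite ler_pM//; [exact: ltW|by rewrite lerDr|].
  by apply: ger1_powR; rewrite ?d0// ltW.
rewrite ge_min; apply/orP; left.
rewrite -[leLHS]mulr1 ler_pM// ?lerDl//.
by rewrite -(powRr0 d); apply: ler_powR; exact: ltW.
Qed.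

Lemma cosn_lip n (x y : R) :
  `|cos (n%:R * x) - cos (n%:R * y)| <= (2 + n%:R) * `|x - y| `^ alpha.
Proof.
apply: le_trans (powR_dist_lip _ _) => //; rewrite le_min; apply/andP; split.
  by rewrite (le_trans (ler_normB _ _))// (_ : 2 = 1 + 1)// lerD// ler_norml cos_geN1 cos_le1.
rewrite (le_trans (cos_lip _ _))// -mulrBr normrM ger0_norm//.
Qed.

Lemma holder_cos_subproof n : (fun x : R => cos (n%:R * x)) \in holder_even_pred alpha.
Proof.
rewrite inE; split => [x|x|].
- by rewrite mulrN cosN.
- by rewrite mulrDr (mulr_natl (pi *+ 2)); exact: (periodicn (@cosD2pi R)).
- exists (2 + n%:R); split => [x|x y]; last exact: cosn_lip.
  by rewrite (@le_trans _ _ 1)// ?ler_norml ?cos_geN1 ?cos_le1// ler_wpDr// ler1n.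
Qed.

(** Total in [alpha] through [insubd]: membership in the Hoelder space holds for
    [0 < alpha < 1] only. *)
Definition hcos n : X := insubd (0 : X) (fun x : R => cos (n%:R * x)).

Lemma hcosE n x : hcos n x = cos (n%:R * x).
Proof. by have := insubdK (0 : X) (holder_cos_subproof n) => /(congr1 (fun f => f x)). Qed.

Lemma hcos_norm n : `|hcos n| <= n%:R + 3.
Proof.
rewrite (_ : _ + _ = 1 + (2 + n%:R)); last by ring.
apply: holder_norm_ubX => [|x|x y]; first by rewrite addr_ge0.
  by rewrite hcosE ler_norml cos_geN1 cos_le1.
by rewrite !hcosE cosn_lip.
Qed.

End HolderAlgebra.

(** * Uniform density of even trigonometric polynomials *)

Section Density.
Context {R : realType} {alpha : R}.
Hypothesis alpha01 : 0 < alpha < 1.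
Notation X := (holder_even alpha).
Notation hcos := (@hcos R alpha).

Inductive cospan : X -> Prop :=
| cospan0 : cospan 0
| cospanD a n f : cospan f -> cospan (a *: hcos n + f).

Lemma cospan_add f g : cospan f -> cospan g -> cospan (f + g).
Proof.
by move=> cf cg; elim: cf => [|a n h _ ch]; rewrite ?add0r// -addrA; constructor.
Qed.

Lemma cospan_scale a f : cospan f -> cospan (a *: f).
Proof.
elim=> [|b n h _ ch]; first by rewrite scaler0; constructor.
by rewrite scalerDr scalerA; constructor.
Qed.

Lemma cospan_cos n : cospan (hcos n).
Proof. by rewrite -[hcos n]addr0 -[hcos n]scale1r; do 2 constructor. Qed.

Lemma cospan_hmul_cos1 f : cospan f -> cospan (hmul (hcos 1) f).
Proof.
elim=> [|a n h _ ch].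
  rewrite (_ : hmul _ _ = 0); first by constructor.
  by apply: holder_even_ext => x; rewrite hmulE mulr0.
rewrite hmulC hmulDl hmulZl (hmulC h); apply: cospan_add => //.
apply: cospan_scale; case: n => [|n].
  rewrite (_ : hmul _ _ = hcos 1); first exact: cospan_cos.
  by apply: holder_even_ext => x; rewrite hmulE !hcosE// mul0r cos0 mul1r.
rewrite (_ : hmul _ _ = 2^-1 *: hcos n + 2^-1 *: hcos n.+2); last first.
  apply: holder_even_ext => x.
  rewrite hmulE holderDE !holderZE !hcosE// -[n.+2%:R]natr1 -[n.+1%:R]natr1.
  rewrite (_ : (n%:R + 1 + 1) * x = (n%:R + 1) * x + 1%:R * x); last by ring.
  rewrite (_ : n%:R * x = (n%:R + 1) * x - 1%:R * x); last by ring.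
  by rewrite cosB cosD; field.
by apply: cospan_add; apply: cospan_scale; exact: cospan_cos.
Qed.

(** Evenness and periodicity fold the line onto [[0, pi]], where [cos] is
    injective. *)
Lemma holder_reduce (x : R) : exists2 y, 0 <= y <= pi &
  forall f : X, f y = f x.
Proof.
wlog x0 : x / 0 <= x.
  move=> H; have [/H//|x0] := leP 0 x.
  have [|y y0 fy] := H (- x); first by rewrite oppr_ge0 ltW.
  exists y => // f; rewrite fy.
  by have [-> _ _] := holder_evenP f.
have p0 : 0 < pi *+ 2 :> R by rewrite mulrn_wgt0 ?pi_gt0.
pose n := Num.truncn (x / (pi *+ 2)).
have /andP[nx xn] : n%:R <= x / (pi *+ 2) < n.+1%:R.
  by apply: Num.Theory.truncn_itv; rewrite divr_ge0// ltW.
pose z := x - (pi *+ 2) *+ n.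
have fz (f : X) : f z = f x.
  have [_ fp _] := holder_evenP f.
  by rewrite -[in RHS](subrK ((pi *+ 2) *+ n) x) (periodicn fp).
have z0 : 0 <= z.
  by rewrite subr_ge0 -mulr_natl -ler_pdivlMr.
have z2 : z < pi *+ 2.
  by rewrite ltrBlDr -mulrS -mulr_natl -ltr_pdivrMr.
have [zp|zp] := leP z pi; first by exists z => //; rewrite z0.
exists (pi *+ 2 - z).
  rewrite subr_ge0 ltW//= lerBlDr mulr2n lerD2l ltW//.
move=> f; have [fe fp _] := holder_evenP f.
by rewrite -fz -[in RHS]fe -[in RHS]fp addrC.
Qed.

(** From [cos (s - h) - cos (s + h) = 2 sin s sin h], both sines being at least
    [sin (d / 2)]. *)
Lemma cos_separation (d : R) : 0 < d <= 1 -> exists2 k : R, 0 < k &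
  forall x y, 0 <= x <= pi -> 0 <= y <= pi -> d <= `|x - y| ->
  k <= `|cos x - cos y|.
Proof.
move=> /andP[d0 d1].
have p2 : (2 : R) <= pi by exact: pi_ge2.
have s0 : 0 < sin (d / 2).
  by apply: sin_gt0_pi; rewrite divr_gt0//=; lra.
exists (2 * sin (d / 2) ^+ 2); first by rewrite mulr_gt0// exprn_gt0.
move=> x y; wlog xy : x y / x <= y.
  move=> H x0 y0 xyd; have [xy|/ltW yx] := leP x y; first exact: H.
  by rewrite distrC; apply: H => //; rewrite distrC.
move=> /andP[x0 xp] /andP[y0 yp] xyd.
have {}xyd : d <= y - x by rewrite -(@ger0_norm _ (y - x)) ?subr_ge0// distrC.
pose h := (y - x) / 2; pose s := (x + y) / 2.
have -> : x = s - h by rewrite /s /h; field.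
have -> : y = s + h by rewrite /s /h; field.
rewrite cosB cosD (_ : _ - _ = 2 * (sin s * sin h)); last by ring.
have sm (u : R) : d / 2 <= u -> u <= pi - d / 2 -> sin (d / 2) <= sin u.
  move=> du up; wlog u2 : u du up / u <= pi / 2.
    move=> H; have [|/ltW u2] := leP u (pi / 2); first exact: H.
    have -> : sin u = sin (pi - u).
      by rewrite sinB sinpi cospi mul0r sub0r mulN1r opprK.
    by apply: H; move: du up u2 p2 d0 d1; lra.
  move: du; rewrite le_eqVlt => /predU1P[->//|du].
  by rewrite ltW// ltr_sin// in_itv/=; move: du up u2 p2 d0 d1; lra.
have s1 : sin (d / 2) <= sin s by apply: sm; rewrite /s; lra.
have s2 : sin (d / 2) <= sin h by apply: sm; rewrite /h; lra.
rewrite normrM ger0_norm// ler_wpM2l// expr2.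
by rewrite (le_trans _ (ler_norm _))// ler_pM// ltW.
Qed.

(** Away from the diagonal the cosines are separated, so the quadratic term
    dominates there; near the diagonal the Hoelder condition applies. This is
    the form of the modulus of continuity that a second moment can integrate. *)
Lemma holder_modulus (f : X) (e : R) : 0 < e -> exists2 D : R, 0 <= D &
  forall x y, `|f x - f y| <= e + D * (cos x - cos y) ^+ 2.
Proof.
move=> e0; have /andP[a0 a1] := alpha01.
pose C := `|f| + 1.
have C0 : 0 < C by rewrite ltr_wpDl.
have fC : holder_norm f <= C by rewrite /C -holder_normE lerDl.
pose r := e / C.
have r0 : 0 < r by rewrite divr_gt0.
pose d := Num.min 1 (r `^ alpha^-1).
have d01 : 0 < d <= 1 by rewrite lt_min ltr01 powR_gt0//= ge_min lexx.
have [k k0 kP] := cos_separation d01.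
exists (2 * C / k ^+ 2); first by rewrite divr_ge0 ?exprn_ge0 ?mulr_ge0// ltW.
move=> x y.
have [x' x'I fx] := holder_reduce x; have [y' y'I fy] := holder_reduce y.
have cx : cos x = cos x' by have := fx (hcos 1); rewrite !hcosE// !mul1r.
have cy : cos y = cos y' by have := fy (hcos 1); rewrite !hcosE// !mul1r.
rewrite cx cy -fx -fy.
have [xyd|xyd] := ltP `|x' - y'| d.
  apply: (@le_trans _ _ e); last first.
    by rewrite lerDl mulr_ge0 ?sqr_ge0// divr_ge0 ?exprn_ge0 ?mulr_ge0// ltW.
  apply: (le_trans (holder_norm_lip _ _ _)).
  rewrite (@le_trans _ _ (C * r))//; last by rewrite mulrC divfK// gt_eqF.
  rewrite ler_pM ?powR_ge0//.
    exact: normr_ge0 f.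
  have rE : r = (r `^ alpha^-1) `^ alpha.
    by rewrite -powRrM mulVf ?gt_eqF// powRr1// ltW.
  rewrite [leRHS]rE.
  apply: ge0_ler_powR; rewrite ?nnegrE ?powR_ge0 ?(ltW a0)//.
  by rewrite (le_trans (ltW xyd))// ge_min lexx orbT.
have kc := kP _ _ x'I y'I xyd.
rewrite -[X in X <= _]add0r lerD ?(ltW e0)//.
apply: (@le_trans _ _ (2 * C)).
  rewrite (le_trans (ler_normB _ _))// mulr_natl mulr2n lerD//.
    exact: le_trans (holder_norm_ub _ _) fC.
  exact: le_trans (holder_norm_ub _ _) fC.
rewrite mulrAC ler_pdivlMr ?exprn_gt0// ler_wpM2l ?mulr_ge0 ?(ltW C0)//.
by rewrite -[leRHS]real_normK ?num_real// ler_sqr// nnegrE ltW.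
Qed.

(** Conditioning a binomial variable on its first trial gives the Bernstein
    polynomials without binomial coefficients, and makes their moments
    accessible to induction on [N]. *)
Fixpoint bernstein N (g : nat -> R) (s : R) : R :=
  if N is N'.+1 then
    s * bernstein N' (g \o succn) s + (1 - s) * bernstein N' g s
  else g 0%N.

(** Second moment estimate: the error [(k - b) ^ 2] averages to the variance
    plus the squared bias. *)
Lemma bernstein_dist N (g : nat -> R) (s v a b D : R) : 0 <= s <= 1 ->
  (forall k, (k <= N)%N -> `|g k - v| <= a + D * (k%:R - b) ^+ 2) ->
  `|bernstein N g s - v| <= a + D * (N%:R * s * (1 - s) + (N%:R * s - b) ^+ 2).
Proof.
move=> /andP[s0 s1]; elim: N g b => [|N IH] g b gv /=.
  by rewrite !mul0r add0r gv.
have := IH (g \o succn) (b - 1); have := IH g b.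
set A := bernstein N g s; set B := bernstein N (g \o succn) s.
move=> hA hB.
have {}hA := hA (fun k kN => gv k (leqW kN)).
have {}hB : `|B - v| <= a + D * (N%:R * s * (1 - s) + (N%:R * s - (b - 1)) ^+ 2).
  apply: hB => k kN; have := gv k.+1 kN; rewrite -natr1.
  by rewrite (_ : k%:R + 1 - b = k%:R - (b - 1))//; ring.
rewrite (_ : _ - v = s * (B - v) + (1 - s) * (A - v)); last by ring.
rewrite (le_trans (ler_normD _ _))// !normrM (ger0_norm s0).
rewrite (@ger0_norm _ (1 - s)) ?subr_ge0//.
have := ler_wpM2l s0 hB; have /ler_wpM2l/(_ _ _ hA) : 0 <= 1 - s by rewrite subr_ge0.
move=> h1 h2; apply: le_trans (lerD h2 h1) _; rewrite le_eqVlt; apply/orP; left.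
by apply/eqP; rewrite -natr1; ring.
Qed.

Lemma cospan_bernstein N g : exists2 q : X, cospan q &
  forall x, q x = bernstein N g ((1 + cos x) / 2).
Proof.
elim: N g => [|N IH] g.
  exists (g 0%N *: hcos 0); first exact/cospan_scale/cospan_cos.
  by move=> x; rewrite holderZE hcosE// mul0r cos0 mulr1.
have [q1 c1 e1] := IH (g \o succn); have [q2 c2 e2] := IH g.
exists (2^-1 *: (q1 + hmul (hcos 1) q1) + 2^-1 *: (q2 + (-1) *: hmul (hcos 1) q2)).
  by do ?[apply: cospan_add|apply: cospan_scale|apply: cospan_hmul_cos1|done].
move=> x.
by rewrite [RHS]/= !(holderDE, holderZE, hmulE) hcosE// mul1r e1 e2; field.
Qed.

(** Even trigonometric polynomials are uniformly dense: these are the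
    polynomials in [cos x], and Bernstein approximation applies to [f \o acos]. *)
Lemma cospan_dense (f : X) (e : R) : 0 < e ->
  exists2 q : X, cospan q & forall x, `|(f - q) x| <= e.
Proof.
move=> e0.
have e20 : 0 < e / 2 by rewrite divr_gt0.
have [D D0 fD] := holder_modulus f e20.
(* the variance contributes at most [D / N] *)
pose N := (Num.truncn (2 * D / e)).+1.
have N0 : 0 < N%:R :> R by rewrite ltr0n.
have [q cq qE] := cospan_bernstein N (fun k => f (acos (2 * k%:R / N%:R - 1))).
exists q => // x; rewrite holderBE distrC qE.
pose s := (1 + cos x) / 2.
have cx1 : -1 <= cos x <= 1 by rewrite cos_geN1 cos_le1.
have s01 : 0 <= s <= 1 by rewrite /s; lra.
have := @bernstein_dist N (fun k => f (acos (2 * k%:R / N%:R - 1))) s (f x)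
  (e / 2) (N%:R * s) (D * (2 / N%:R) ^+ 2) s01.
move=> h; apply: le_trans (h _) _ => [k kN|].
  apply: le_trans (fD _ _) _; rewrite acosK; last first.
    rewrite in_itv/= -mulrA.
    have k0 : 0 <= k%:R / N%:R :> R by rewrite divr_ge0.
    have k1 : k%:R / N%:R <= 1 :> R by rewrite ler_pdivrMr// mul1r ler_nat.
    by apply/andP; split; lra.
  rewrite lerD2l -[leRHS]mulrA ler_wpM2l// -exprMn le_eqVlt; apply/orP; left; apply/eqP.
  by congr (_ ^+ 2); rewrite /s; field; rewrite gt_eqF.
rewrite subrr expr0n/= addr0.
rewrite [leRHS](splitr e) lerD2l.
apply: (@le_trans _ _ (D / N%:R)).
  rewrite (_ : _ * _ = D / N%:R * (4 * (s * (1 - s)))); last first.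
    by field; rewrite gt_eqF.
  rewrite ler_piMr ?divr_ge0//.
  by have := sqr_ge0 (2 * s - 1); move: s01; nra.
rewrite ler_pdivrMr// -ler_pdivrMl// invf_div.
have q0 : 0 <= 2 * D / e by rewrite divr_ge0 ?mulr_ge0// ltW.
have /andP[_ /ltW] := Num.Theory.truncn_itv q0.
by rewrite -/N mulrAC mulrC mulrCA mulrA.
Qed.

(** All identities between operators below are checked on cosines and
    extended by this principle. *)
Lemma cos_ext (l : X -> R) (C : R) :
  (forall a (f g : X), l (a *: f + g) = a * l f + l g) ->
  (forall (f : X) B, (forall x, `|f x| <= B) -> `|l f| <= C * B) ->
  (forall n, l (hcos n) = 0) -> forall f, l f = 0.
Proof.
move=> ll lC lcos f.
have l0 : l 0 = 0.
  have := ll (-1) 0 0; rewrite scaler0 addr0; lra.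
have lspan q : cospan q -> l q = 0.
  by elim=> [//|a n h _ ch]; rewrite ll lcos ch mulr0 addr0.
apply/eqP; rewrite -normr_le0; apply/ler_addgt0Pl => e e0; rewrite addr0.
have C10 : 0 < `|C| + 1 by rewrite ltr_wpDl.
have [q cq fq] := cospan_dense f (divr_gt0 e0 C10).
have -> : l f = l (f - q).
  by rewrite -scaleN1r addrC ll (lspan _ cq) mulr0 add0r.
apply: (le_trans (lC _ _ fq)).
rewrite mulrCA ger_pMr// ler_pdivrMr// mul1r (le_trans (ler_norm _))// lerDl//.
Qed.
End Density.

(** * The convolution operator *)

Section HolderContinuity.
Context {R : realType} {alpha : R}.
Hypothesis alpha01 : 0 < alpha < 1.
Notation X := (holder_even alpha).

Lemma holder_continuous (f : X) : continuous f.
Proof.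
have /andP[a0 a1] := alpha01.
move=> x; apply/cvgrPdist_lt => e e0.
have C0 : 0 < holder_norm f + 1 by rewrite ltr_wpDl// -holder_normE.
pose r := (e / (holder_norm f + 1)) `^ alpha^-1.
have r0 : 0 < r by rewrite powR_gt0// divr_gt0.
near=> y.
apply: (le_lt_trans (holder_norm_lip _ _ _)).
have xy : `|x - y| < r by near: y; exact: cvgr_dist_lt.
have : `|x - y| `^ alpha < r `^ alpha by apply: gt0_ltr_powR; rewrite // nnegrE ltW.
rewrite -powRrM mulVf ?gt_eqF// powRr1 ?divr_ge0 ?(ltW e0) ?(ltW C0)//.
rewrite ltr_pdivlMr// mulrC; apply: le_lt_trans.
by rewrite ler_wpM2r ?powR_ge0// lerDl.
Unshelve. all: by end_near. Qed.

End HolderContinuity.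

Section Kernel.
Context {R : realType} (K : R -> R).
Notation leb := (@lebesgue_measure R).
Hypothesis iK : leb.-integrable setT (EFin \o K).

(** The values of [K * f] are pairings of [K] with reflected translates of [f]. *)
Definition kernel_pairing (g : R -> R) : R := \int[leb]_(y in setT) (K y * g y).
Definition kernel_mass : R := \int[leb]_(y in setT) `|K y|.

Lemma kernel_mass_ge0 : 0 <= kernel_mass.
Proof. by apply: Rintegral_ge0. Qed.

Lemma integrable_pairing (g : R -> R) B : continuous g -> (forall y, `|g y| <= B) ->
  leb.-integrable setT (EFin \o (fun y => K y * g y)).
Proof.
move=> cg gB.
suff : leb.-integrable setT ((EFin \o K) \* (EFin \o g))%E by [].
apply: integrableMl => //; first exact: continuous_measurable_fun.
exists B; split; first exact: num_real.
by move=> M BM y _ /=; rewrite (le_trans (gB y))// ltW.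
Qed.

Lemma kernel_pairing_le (g : R -> R) B : continuous g -> (forall y, `|g y| <= B) ->
  `|kernel_pairing g| <= kernel_mass * B.
Proof.
move=> cg gB; have iKg := integrable_pairing cg gB.
rewrite (le_trans (le_normr_Rintegral _ _))// /kernel_mass -RintegralZr//; last first.
  exact: integrable_norm.
apply: le_Rintegral => //.
- exact: integrable_norm.
- exact: (integrableZr measurableT B (integrable_norm iK)).
- by move=> x _; rewrite normrM ler_wpM2l.
Qed.

Lemma kernel_pairingD a (g h : R -> R) B C : continuous g -> continuous h ->
  (forall y, `|g y| <= B) -> (forall y, `|h y| <= C) ->
  kernel_pairing (fun y => a * g y + h y) = a * kernel_pairing g + kernel_pairing h.
Proof.
move=> cg ch gB hC.
have iKg := integrable_pairing cg gB; have iKh := integrable_pairing ch hC.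
rewrite /kernel_pairing -RintegralZl// -RintegralD//.
  by apply: eq_Rintegral => x _; ring.
exact: (integrableZl measurableT a iKg).
Qed.

End Kernel.

Section WhithamOperator.
Context {R : realType} {alpha : R} {K : R -> R}.
Hypothesis alpha01 : 0 < alpha < 1.
Hypothesis hK : is_whitham_kernel K.
Notation X := (holder_even alpha).
Notation hcos := (@hcos R alpha).
Notation mass := (kernel_mass K).

Let iK := hK.1.

Lemma convolutionE f x : convolution K f x = kernel_pairing K (fun y => f (x - y)).
Proof. by []. Qed.

Let shift_continuous (f : X) x : continuous (fun y => f (x - y)).
Proof.
move=> y; apply: (@continuous_comp _ _ _ (fun y => x - y) f); last exact: holder_continuous.
by apply: cvgB; [exact: cvg_cst|exact: cvg_id].
Qed.

Lemma convolution_le (f : X) B x : (forall y, `|f y| <= B) ->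
  `|convolution K f x| <= mass * B.
Proof. by move=> fB; apply: (kernel_pairing_le iK) => //; exact: shift_continuous. Qed.

Lemma convolution_linear a (f g : X) x :
  convolution K (a *: f + g) x = a * convolution K f x + convolution K g x.
Proof.
by apply: (@kernel_pairingD _ _ iK _ _ _ `|f| `|g|) => [||y|y];
  [exact: shift_continuous|exact: shift_continuous|exact: holder_norm_ub..].
Qed.

Lemma convolution_dist (f : X) D x y :
  (forall x y, `|f x - f y| <= D * `|x - y| `^ alpha) ->
  `|convolution K f x - convolution K f y| <= (mass * D) * `|x - y| `^ alpha.
Proof.
move=> fD; rewrite addrC -mulN1r -mulrA !convolutionE.
rewrite -(@kernel_pairingD _ _ iK _ _ _ `|f| `|f|); last first.
- by move=> z; exact: holder_norm_ub.
- by move=> z; exact: holder_norm_ub.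
- exact: shift_continuous.
- exact: shift_continuous.
apply: (kernel_pairing_le iK) => z.
  by apply: cvgD; [apply: cvgMl_tmp; exact: shift_continuous|exact: shift_continuous].
rewrite mulN1r addrC (le_trans (fD _ _))//.
by rewrite (_ : x - z - (y - z) = x - y)//; ring.
Qed.

Lemma convolution_cos n x :
  convolution K (hcos n) x = whitham_symbol n%:R * cos (n%:R * x).
Proof.
have [re im] : kernel_pairing K (fun y => cos (y * n%:R)) = whitham_symbol n%:R /\
    kernel_pairing K (fun y => sin (y * n%:R)) = 0.
  have [re im] := hK.2 n%:R; split; first exact: re.
  by apply/eqP; rewrite -oppr_eq0; apply/eqP; exact: im.
rewrite convolutionE.
have -> : (fun y => hcos n (x - y)) = (fun y => cos (n%:R * x) * cos (y * n%:R)
    + sin (n%:R * x) * sin (y * n%:R)).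
  by apply/funext => y; rewrite hcosE// mulrBr cosB (mulrC y).
have cl (h : R -> R) : continuous h -> continuous (fun y : R => h (y * n%:R)).
  move=> ch y; apply: (@continuous_comp R R R (fun y : R => y * n%:R) h); last exact: ch.
  by apply: cvgMr_tmp; exact: cvg_id.
rewrite (@kernel_pairingD _ _ iK _ _ _ 1 `|sin (n%:R * x)|); first last.
- by move=> y; rewrite normrM ler_piMr// ler_norml sin_geN1 sin_le1.
- by move=> y; rewrite ler_norml cos_geN1 cos_le1.
- by move=> y; apply: cvgMl_tmp; apply: cl; exact: continuous_sin.
- by apply: cl; exact: continuous_cos.
rewrite re (_ : kernel_pairing _ _ = 0); first by rewrite addr0 mulrC.
have k0 : kernel_pairing K (fun=> 0) = 0.
  by have := RintegralZr 0 measurableT iK; rewrite mulr0.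
have := @kernel_pairingD _ _ iK (sin (n%:R * x)) (fun y => sin (y * n%:R)) (fun=> 0) 1 0.
rewrite im mulr0 k0 addr0 => h; rewrite -[RHS]h.
- by congr (kernel_pairing K _); apply/funext => y; rewrite addr0.
- by apply: cl; exact: continuous_sin.
- by move=> y; exact: cvg_cst.
- by move=> y; rewrite ler_norml sin_geN1 sin_le1.
- by move=> y; rewrite normr0.
Qed.

(** On cosines evenness follows from the vanishing of the sine transform of [K];
    density extends it. *)
Lemma convolution_even (f : X) x : convolution K f (- x) = convolution K f x.
Proof.
apply/eqP; rewrite -subr_eq0; apply/eqP; move: f.
apply: (@cos_ext _ _ alpha01
  (fun f : X => convolution K f (- x) - convolution K f x) (mass + mass)).
- by move=> a f g; rewrite !convolution_linear; ring.
- move=> f B fB; rewrite (le_trans (ler_normB _ _))// mulrDl.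
  by rewrite lerD// convolution_le.
- by move=> n; rewrite !convolution_cos mulrN cosN subrr.
Qed.

Lemma convolution_subproof (f : X) : convolution K f \in holder_even_pred alpha.
Proof.
rewrite inE; split => [|x|].
- exact: convolution_even.
- have [_ fp _] := holder_evenP f.
  rewrite !convolutionE; congr (kernel_pairing K _); apply/funext => y.
  by rewrite addrAC fp.
- exists (mass * `|f|); split => [x|x y].
    by apply: convolution_le; exact: holder_norm_ub.
  by apply: convolution_dist; exact: holder_norm_lip.
Qed.

Definition Lw (f : X) : X := insubd (0 : X) (convolution K f).

Lemma LwE (f : X) : Lw f =1 convolution K f.
Proof. by move=> x; have /(congr1 (@^~ x)) := insubdK (0 : X) (convolution_subproof f). Qed.

Lemma Lw_linear a (f g : X) : Lw (a *: f + g) = a *: Lw f + Lw g.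
Proof.
apply: holder_even_ext => x.
by rewrite holderDE holderZE !LwE convolution_linear.
Qed.

Lemma Lw_sup (f : X) B : (forall x, `|f x| <= B) -> forall x, `|Lw f x| <= mass * B.
Proof. by move=> fB x; rewrite LwE convolution_le. Qed.

Lemma Lw_norm (f : X) : `|Lw f| <= 2 * mass * `|f|.
Proof.
rewrite -mulrA mulr_natl mulr2n; apply: holder_norm_ubX => [|x|x y].
- by rewrite mulr_ge0// kernel_mass_ge0.
- by apply: Lw_sup; exact: holder_norm_ub.
- by rewrite !LwE; apply: convolution_dist; exact: holder_norm_lip.
Qed.

Lemma Lw_cos n : Lw (hcos n) = whitham_symbol n%:R *: hcos n.
Proof.
by apply: holder_even_ext => x; rewrite holderZE LwE convolution_cos hcosE.
Qed.

Lemma whitham_solutionE (f : X) mu :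
  whitham_solution K f mu <-> mu *: f - Lw f = hmul f f.
Proof.
split => [h|h x].
  apply: holder_even_ext => x; have := h x; rewrite /whitham_F -LwE.
  by rewrite hmulE holderBE holderZE expr2 => /eqP; rewrite subr_eq0 => /eqP.
rewrite /whitham_F -LwE -holderZE -holderBE h hmulE expr2 subrr//.
Qed.

End WhithamOperator.

(** * The symbol at the integers *)

Section Symbol.
Context {R : realType}.
Local Notation m n := (@whitham_symbol R n%:R).

Let a : R := expR 2.
Let a_gt1 : 1 < a. Proof. by rewrite expR_gt1. Qed.
Let F n : R := expR 2 ^+ n.
Let F_ge1 n : 1 <= F n. Proof. by rewrite exprn_ege1// ltW. Qed.
Let FS n : F n.+1 = a * F n. Proof. by rewrite /F exprS. Qed.

(** In terms of powers of [expR 2] the increments of [tanh] on the integers are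
    rational functions, which makes their monotonicity algebraic. *)
Lemma tanh_nat n : tanh n%:R = 1 - 2 / (expR 2 ^+ n + 1) :> R.
Proof.
rewrite /tanh -expRM_natr expRM_natl expRN; set E := expR n%:R.
have E0 : 0 < E by exact: expR_gt0.
by field; rewrite !gt_eqF// addr_gt0// mulr_gt0.
Qed.

Let t n : R := tanh n%:R.
Let d n : R := t n.+1 - t n.

Let dE n : d n = 2 * F n * (a - 1) / ((F n + 1) * (a * F n + 1)).
Proof.
rewrite /d /t !tanh_nat -/(F n) -/(F n.+1) FS; field.
by apply/andP; split; apply: lt0r_neq0; have := F_ge1 n; have := a_gt1; nra.
Qed.

Let d_decr n : d n.+1 < d n.
Proof.
rewrite !dE FS; have F1 := F_ge1 n; have a1 := a_gt1.
have F0 : 0 < F n by exact: lt_le_trans F1.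
have a0 : 0 < a by exact: lt_trans a1.
have aF : 0 < a * F n + 1 by rewrite addr_gt0// mulr_gt0.
rewrite ltr_pdivrMr; last by rewrite !mulr_gt0// addr_gt0// !mulr_gt0.
rewrite [ltRHS]mulrAC ltr_pdivlMr; last by rewrite !mulr_gt0// addr_gt0.
set f := F n in F1 F0 aF *.
have -> : 2 * (a * f) * (a - 1) * ((f + 1) * (a * f + 1)) =
  (2 * f * (a - 1) * (a * f + 1)) * (a * (f + 1)) by ring.
have -> : 2 * f * (a - 1) * ((a * f + 1) * (a * (a * f) + 1)) =
  (2 * f * (a - 1) * (a * f + 1)) * (a * (a * f) + 1) by ring.
rewrite ltr_pM2l; last by rewrite !mulr_gt0// subr_gt0.
have : 0 < (a - 1) * (a * f - 1).
  by rewrite mulr_gt0 ?subr_gt0// (lt_le_trans a1)// ler_peMr// ltW.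
by rewrite -subr_gt0; congr (0 < _); ring.
Qed.

Let t0 : t 0 = 0. Proof. by rewrite /t tanh_nat expr0; field. Qed.

Let tS n : t n.+1 = t n + d n. Proof. by rewrite /d addrC subrK. Qed.

(** [tanh n] is a sum of [n] increments, all larger than the next one. *)
Let chord n : (0 < n)%N -> n%:R * d n < t n.
Proof.
have le k : k%:R * d k <= t k.
  elim: k => [|k IH]; first by rewrite t0 mul0r.
  rewrite tS -natr1 mulrDl mul1r lerD//.
    by rewrite (le_trans _ IH)// ler_wpM2l// ltW// d_decr.
  exact/ltW/d_decr.
case: n => // n _; rewrite tS -natr1 mulrDl mul1r ler_ltD//.
by rewrite (le_trans _ (le n))// ler_wpM2l// ltW// d_decr.
Qed.

Let t_lt1 n : t n < 1.
Proof. by rewrite /t tanh_nat gtrBl divr_gt0// addr_gt0// exprn_gt0// expR_gt0. Qed.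

Let t_gt0 n : (0 < n)%N -> 0 < t n.
Proof.
move=> n0; apply: le_lt_trans (chord n0); rewrite mulr_ge0// dE.
have F1 := F_ge1 n; have a1 := a_gt1.
have F0 : 0 < F n by exact: lt_le_trans F1.
by rewrite divr_ge0// ltW// !mulr_gt0 ?subr_gt0// addr_gt0// mulr_gt0// (lt_trans _ a1).
Qed.

Lemma symbol0 : m 0%N = 1. Proof. by rewrite /whitham_symbol eqxx. Qed.

Lemma symbolE n : (0 < n)%N -> m n = whitham_speed n.
Proof. by move=> n0; rewrite /whitham_symbol pnatr_eq0 -[n == 0%N]negbK -lt0n n0. Qed.

Lemma symbol_gt0 n : 0 < m n.
Proof.
case: n => [|n]; first by rewrite symbol0.
by rewrite symbolE// sqrtr_gt0 divr_gt0// t_gt0.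
Qed.

Let symbol_sqr n : (0 < n)%N -> m n ^+ 2 = t n / n%:R.
Proof. by move=> n0; rewrite symbolE// sqr_sqrtr// divr_ge0// ltW// t_gt0. Qed.

(** After clearing denominators, the monotonicity of [tanh n / n] says that
    [tanh n] exceeds [n] times its next increment. *)
Lemma symbol_decr n : m n.+1 < m n.
Proof.
rewrite -ltr_sqr ?nnegrE ?ltW ?symbol_gt0// symbol_sqr//.
case: n => [|n]; first by rewrite symbol0 expr1n divr1 t_lt1.
rewrite symbol_sqr// ltr_pdivrMr// [ltRHS]mulrAC ltr_pdivlMr//.
rewrite [t n.+2]tS [n.+2%:R]mulrSr mulrDl mulrDr mulr1 ltrD2l.
by rewrite mulrC; exact: chord.
Qed.

Lemma symbol_inj n k : m n = m k -> n = k.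
Proof.
have lt i j : (i < j)%N -> m j < m i.
  elim: j => // j IH; rewrite ltnS leq_eqVlt => /predU1P[->|/IH ij]; first exact: symbol_decr.
  exact: lt_trans (symbol_decr j) ij.
move=> nk; have [/lt|/lt|//] := ltngtP n k; first by rewrite nk ltxx.
by rewrite nk ltxx.
Qed.

Lemma symbol_lt1 n : (0 < n)%N -> m n < 1.
Proof.
case: n => // n _; elim: n => [|n IH]; first by rewrite -[ltRHS]symbol0; exact: symbol_decr.
exact: lt_trans (symbol_decr _) IH.
Qed.

Lemma symbol_sqr_le n : (0 < n)%N -> m n ^+ 2 <= n%:R^-1.
Proof. by move=> n0; rewrite symbol_sqr// ler_piMl// ltW// t_lt1. Qed.

Lemma symbol_pow6_le n : m n ^+ 6 <= 8 / n.+1%:R ^+ 3.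
Proof.
case: n => [|n]; first by rewrite symbol0 !expr1n divr1 ler1n.
rewrite (_ : 6 = 2 * 3)%N// exprM (@le_trans _ _ (n.+1%:R^-1 ^+ 3))//.
  by rewrite ler_pXn2r ?nnegrE ?exprn_ge0 ?invr_ge0 ?symbol_sqr_le// ltW// symbol_gt0.
rewrite ler_pdivlMr ?exprn_gt0// exprVn mulrC ler_pdivrMr ?exprn_gt0//.
rewrite (_ : 8 = 2 ^+ 3); last by ring.
by rewrite -exprMn ler_pXn2r ?nnegrE// ?mulr_ge0// -natrM ler_nat mul2n -addnn addnS ltnS leq_addr.
Qed.

(** The symbol tends to [0], which lies below [mu], so only finitely many modes
    come near [mu]. *)
Lemma symbol_gap (mu : R) : 0 < mu -> exists2 d : R, 0 < d &
  forall n, m n != mu -> d <= `|mu - m n|.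
Proof.
move=> mu0; pose N := (Num.truncn ((2 / mu) ^+ 2)).+1.
have big n : (N <= n)%N -> mu / 2 <= `|mu - m n|.
  move=> Nn; have n0 : (0 < n)%N by exact: leq_trans Nn.
  rewrite (le_trans _ (ler_norm _))//.
  suff : m n <= mu / 2 by lra.
  rewrite -ler_sqr ?nnegrE ?divr_ge0 ?(ltW mu0) ?(ltW (symbol_gt0 _))//.
  rewrite (le_trans (symbol_sqr_le n0))//.
  rewrite -[leRHS]invrK lef_pV2 ?posrE ?invr_gt0 ?ltr0n ?exprn_gt0 ?divr_gt0//.
  rewrite -exprVn invf_div (@le_trans _ _ N%:R) ?ler_nat//.
  have q0 : 0 <= (2 / mu) ^+ 2 by rewrite exprn_ge0// divr_ge0// ltW.
  by have /andP[_ /ltW] := Num.Theory.truncn_itv q0.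
have small k : exists2 d : R, 0 < d &
    forall n, (n < k)%N -> m n != mu -> d <= `|mu - m n|.
  elim: k => [|k [e e0 eP]]; first by exists 1.
  have [mk|mk] := eqVneq (m k) mu.
    exists e => // n; rewrite ltnS leq_eqVlt => /predU1P[->|]; last exact: eP.
    by rewrite mk eqxx.
  exists (Num.min e `|mu - m k|).
    by rewrite lt_min e0 normr_gt0 subr_eq0 eq_sym.
  move=> n; rewrite ltnS leq_eqVlt => /predU1P[->|nk nmu]; rewrite ge_min.
    by rewrite lexx orbT.
  by rewrite eP.
have [e e0 eP] := small N.
exists (Num.min e (mu / 2)); first by rewrite lt_min e0 divr_gt0.
move=> n nmu; rewrite ge_min; have [nN|Nn] := ltnP n N; first by rewrite eP.
by rewrite big ?orbT.
Qed.

End Symbol.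

(** * Cosine coefficients *)

Section CosineCoefficient.
Context {R : realType} {alpha : R}.
Hypothesis alpha01 : 0 < alpha < 1.
Notation X := (holder_even alpha).
Notation hcos := (@hcos R alpha).
Notation leb := (@lebesgue_measure R).

Definition half_period (f : R -> R) : R := \int[leb]_(x in `[0, pi]) f x.

Lemma integrable_half_period (f : R -> R) : continuous f ->
  leb.-integrable `[0, pi] (EFin \o f).
Proof.
move=> cf; apply: continuous_compact_integrable; first exact: segment_compact.
exact: continuous_subspaceT.
Qed.

Lemma half_period_linear a (f g : R -> R) : continuous f -> continuous g ->
  half_period (fun x => a * f x + g x) = a * half_period f + half_period g.
Proof.
move=> /integrable_half_period f1 /integrable_half_period g1.
rewrite /half_period -RintegralZl// -RintegralD//.
exact: (integrableZl _ a f1).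
Qed.

Lemma half_period_le (f : R -> R) B : continuous f -> (forall x, `|f x| <= B) ->
  `|half_period f| <= B * pi.
Proof.
move=> cf fB; have if1 := integrable_half_period cf.
rewrite (le_trans (le_normr_Rintegral _ _))//.
rewrite (_ : B * pi = \int[leb]_(x in `[0, pi]) B); last first.
  rewrite Rintegral_cst//=; rewrite lebesgue_measure_itv/= lte_fin pi_gt0/= subr0//.
apply: le_Rintegral => //; first exact: integrable_norm.
apply: integrable_half_period => x; exact: cvg_cst.
Qed.

Lemma half_period_FTC (F f : R -> R) : (forall x : R, is_derive x 1 F (f x)) ->
  continuous f -> half_period f = F pi - F 0.
Proof.
move=> dF cf; rewrite /half_period /Rintegral (@continuous_FTC2 _ f F)//.
- exact: pi_gt0.
- exact: continuous_subspaceT.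
- have cF : continuous F.
    by move=> x; apply: differentiable_continuous; apply/derivable1_diffP; case: (dF x).
  split.
  + by move=> x _; case: (dF x).
  + by apply: cvg_at_right_filter; exact: cF.
  + by apply: cvg_at_left_filter; exact: cF.
- by move=> x _; rewrite derive1E; case: (dF x).
Qed.

Lemma continuous_cosM (k : R) : continuous (fun x : R => cos (k * x)).
Proof.
move=> x; apply: (@continuous_comp R R R (fun x : R => k * x) cos); last exact: continuous_cos.
by apply: cvgMl_tmp; exact: cvg_id.
Qed.

Lemma half_period_cos k : half_period (fun x => cos (k%:R * x)) = pi *+ (k == 0)%N.
Proof.
case: k => [|k].
  have did (x : R) : is_derive x 1 id (cos (0 * x)) by rewrite mul0r cos0; exact: is_derive_id.
  by rewrite (half_period_FTC did) ?subr0//; exact: continuous_cosM.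
have dsin (x : R) : is_derive x 1 (fun x => k.+1%:R^-1 * sin (k.+1%:R * x)) (cos (k.+1%:R * x)).
  have d1 : is_derive x 1 (fun x : R => k.+1%:R * x) k.+1%:R.
    by apply: is_derive_eq; rewrite /GRing.scale/= ?mulr1 ?mulr0 ?addr0.
  have d2 := is_derive1_comp (is_derive_sin (k.+1%:R * x)) d1.
  have d3 := is_deriveZ k.+1%:R^-1 d2.
  apply: is_derive_eq.
  by rewrite /GRing.scale/= mulrCA mulVf ?mulr1.
rewrite (half_period_FTC dsin); last exact: continuous_cosM.
have -> : sin (k.+1%:R * pi) = 0 :> R.
  elim: k.+1 => [|n IH]; first by rewrite mul0r sin0.
  by rewrite -natr1 mulrDl mul1r sinDpi IH oppr0.
by rewrite !mulr0 sin0 mulr0 subr0.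
Qed.

(** For even functions half a period carries the whole coefficient. *)
Definition coef n (f : X) : R :=
  (if n == 0%N then 1 else 2) / pi * half_period (fun x => f x * cos (n%:R * x)).

Let cfc n (f : X) : continuous (fun x => f x * cos (n%:R * x)).
Proof. by move=> x; apply: cvgM; [exact: holder_continuous|exact: continuous_cosM]. Qed.

Lemma coef_linear n a (f g : X) : coef n (a *: f + g) = a * coef n f + coef n g.
Proof.
rewrite /coef -[X in _ = X + _]mulrCA -mulrDr -half_period_linear; [|exact: cfc..].
congr (_ * half_period _); apply/funext => x; rewrite holderDE holderZE; ring.
Qed.

Lemma coef_le n (f : X) B : (forall x, `|f x| <= B) -> `|coef n f| <= 2 * B.
Proof.
move=> fB; have B0 : 0 <= B by exact: le_trans (fB 0).
have p0 : 0 < pi :> R := pi_gt0 R.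
have -> : 2 * B = 2 / pi * (B * pi).
  by move: (pi : R) p0 => p p0; field; rewrite gt_eqF.
rewrite /coef normrM.
rewrite ler_pM//.
  rewrite normrM normfV (gtr0_norm p0) ler_pM2r ?invr_gt0//.
  by case: ifP => _; rewrite ger0_norm// ler1n.
apply: half_period_le; first exact: cfc.
move=> x; rewrite normrM (le_trans (ler_piMr _ _))//.
by rewrite ler_norml cos_geN1 cos_le1.
Qed.

Lemma coef_cos n k : coef n (hcos k) = (n == k)%:R.
Proof.
have p0 : pi != 0 :> R by rewrite gt_eqF// pi_gt0.
have key i j : (i <= j)%N -> half_period (fun x => cos (j%:R * x) * cos (i%:R * x)) =
    2^-1 * (pi *+ (j - i == 0)%N) + 2^-1 * (pi *+ (j + i == 0)%N).
  move=> ij; rewrite -!half_period_cos.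
  have -> : 2^-1 * half_period (fun x => cos ((j + i)%:R * x)) =
      half_period (fun x => 2^-1 * cos ((j + i)%:R * x)).
    rewrite /half_period RintegralZl//; apply: integrable_half_period; exact: continuous_cosM.
  rewrite -half_period_linear; last 2 first.
  - exact: continuous_cosM.
  - by move=> x; apply: cvgMl_tmp; exact: continuous_cosM.
  congr half_period; apply/funext => x.
  by rewrite natrD natrB// mulrBl mulrDl cosB cosD; field.
have [nk|kn] := leqP n k.
  rewrite /coef (_ : half_period _ = half_period (fun x => cos (k%:R * x) * cos (n%:R * x))).
    rewrite key// subn_eq0 addn_eq0.
    have [->|n0] := eqVneq n 0%N.
      rewrite leqn0 (eq_sym 0%N) ?eqxx ?andbT.
      by move: (pi : R) p0 => p p0; case: (k == 0%N); rewrite ?mulr1n ?mulr0n; field.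
    rewrite andbF mulr0n mulr0 addr0 (_ : (k <= n)%N = (n == k)); last by rewrite eqn_leq nk.
    by move: (pi : R) p0 => p p0; case: eqP => _; rewrite ?mulr1n ?mulr0n; field.
  by congr half_period; apply/funext => x; rewrite hcosE.
rewrite /coef (_ : half_period _ = half_period (fun x => cos (n%:R * x) * cos (k%:R * x))).
  rewrite key// 1?ltnW// subn_eq0 addn_eq0.
  rewrite leqNgt kn (gtn_eqF kn) (gtn_eqF (leq_ltn_trans (leq0n k) kn)) !mulr0n.
  by rewrite !mulr0 addr0 mulr0.
by congr half_period; apply/funext => x; rewrite hcosE// mulrC.
Qed.
End CosineCoefficient.

(** * Dominated series *)

Section NormedSeries.
Context {R : realType}.

Lemma cvg_norm_le {V : normedModType R} (u : nat -> V) (l : V) M :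
  u @ \oo --> l -> (forall n, `|u n| <= M) -> `|l| <= M.
Proof.
move=> /cvg_norm ul uM; apply: (cvgr_to_le ul).
by apply: nearW.
Qed.

(** Weierstrass test, with the bound on the sum. *)
Lemma series_dominated {V : completeNormedModType R} (u : nat -> V) (b : nat -> R) M :
  (forall n, `|u n| <= b n) -> (forall n, series b n <= M) ->
  cvgn (series u) /\ `|limn (series u)| <= M.
Proof.
move=> ub bM.
have cu : cvgn (series u).
  apply: normed_cvg; apply: nondecreasing_is_cvgn.
    by apply: nondecreasing_series => n _ _ /=.
  exists M => _ [n _ <-]; apply: le_trans (bM n).
  by apply: ler_sum => i _; exact: ub.
split=> //; apply: (cvg_norm_le cu) => n; apply: le_trans (bM n).
by apply: (le_trans (ler_norm_sum _ _ _)); apply: ler_sum => i _; exact: ub.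
Qed.

(** Telescoping against [1 / n]. *)
Lemma series_inv_sq n : series (fun i => (i.+1%:R ^+ 2)^-1) n <= 2 :> R.
Proof.
have le k : series (fun i => (i.+1%:R ^+ 2)^-1) k.+1 <= 2 - k.+1%:R^-1 :> R.
  elim: k => [|k IH].
    by rewrite seriesEnat/= big_nat1 expr1n invr1; lra.
  rewrite seriesSr (le_trans (lerD IH (lexx _)))//.
  have k0 : 0 < k.+1%:R :> R by rewrite ltr0n.
  rewrite -[k.+2%:R]natr1; move: (k.+1%:R : R) k0 => x x0.
  have -> : 2 - x^-1 + ((x + 1) ^+ 2)^-1 = 2 - (x + 1)^-1 - (x * (x + 1) ^+ 2)^-1.
    by field; rewrite !gt_eqF// addr_gt0.
  by rewrite gerBl invr_ge0 mulr_ge0 ?exprn_ge0 ?addr_ge0// ltW.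
case: n => [|n]; first by rewrite seriesEnat/= big_geq.
by rewrite (le_trans (le n))// gerBl invr_ge0.
Qed.

Lemma series_geometric_half n : series (fun i => 2^-1 ^+ i) n <= 2 :> R.
Proof.
have -> : series (fun i => 2^-1 ^+ i) n = 2 - 2 * 2^-1 ^+ n :> R.
  elim: n => [|n IH]; first by rewrite seriesEnat/= big_geq// expr0; lra.
  by rewrite seriesSr IH exprS; field.
by rewrite gerBl mulr_ge0// exprn_ge0// invr_ge0.
Qed.

End NormedSeries.

(** * Multipliers and the resolvent *)

Section Multipliers.
Context {R : realType} {alpha : R} {K : R -> R}.
Hypothesis alpha01 : 0 < alpha < 1.
Hypothesis hK : is_whitham_kernel K.
Notation X := (holder_even alpha).
Notation hcos := (@hcos R alpha).
Notation Lw := (@Lw R alpha K).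
Local Notation m n := (@whitham_symbol R n%:R).

(** The bound by the supremum norm is what lets identities be checked on
    cosines, the one by the Hoelder norm is what the contraction arguments use. *)
Definition multiplier (s : nat -> R) (S : X -> X) : Prop :=
  [/\ forall a f g, S (a *: f + g) = a *: S f + S g,
      exists2 C : R, 0 <= C & (forall f : X, `|S f| <= C * `|f|) /\
        forall (f : X) B, (forall x, `|f x| <= B) -> forall x, `|S f x| <= C * B
    & forall n, S (hcos n) = s n *: hcos n].

Lemma multiplier_ext s S s' S' : multiplier s S -> multiplier s' S' -> s =1 s' -> S =1 S'.
Proof.
move=> [Sl [C C0 [_ SC]] Sc] [Sl' [C' C0' [_ SC']] Sc'] ss f.
apply: holder_even_ext => x; apply/eqP; rewrite -subr_eq0; apply/eqP; move: f.
apply: (@cos_ext _ _ alpha01 (fun f : X => S f x - S' f x) (C + C')).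
- by move=> a f g; rewrite Sl Sl' !holderDE !holderZE; ring.
- move=> f B fB; rewrite (le_trans (ler_normB _ _))// mulrDl lerD//.
    exact: SC.
  exact: SC'.
- by move=> n; rewrite Sc Sc' ss subrr.
Qed.

Lemma multiplier_id : multiplier (fun=> 1) id.
Proof.
split=> [//||n]; last by rewrite scale1r.
by exists 1 => //; split=> [f|f B fB x]; rewrite mul1r.
Qed.

Lemma multiplier_Lw : multiplier (fun n => m n) Lw.
Proof.
split; [exact: Lw_linear| |exact: Lw_cos].
have M0 := kernel_mass_ge0 K.
exists (2 * kernel_mass K); first by rewrite mulr_ge0.
split=> [f|f B fB x]; first exact: Lw_norm.
rewrite (le_trans (Lw_sup alpha01 hK fB x))// ler_wpM2r//.
  exact: le_trans (fB 0).
by rewrite ler_peMl// ler1n.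
Qed.

Lemma multiplier_comp s S s' S' : multiplier s S -> multiplier s' S' ->
  multiplier (fun n => s n * s' n) (S \o S').
Proof.
move=> [Sl [C C0 [SC SC1]] Sc] [Sl' [C' C0' [SC' SC1']] Sc'].
have S0 : S 0 = 0.
  by have := Sl 1 0 0; rewrite !scale1r add0r => /esym/eqP; rewrite -subr_eq0 addrK => /eqP.
split.
- by move=> a f g /=; rewrite Sl' Sl.
- exists (C * C'); first by rewrite mulr_ge0.
  split=> [f|f B fB x] /=.
    by rewrite (le_trans (SC _))// -mulrA ler_wpM2l.
  by rewrite -mulrA; apply: SC1; exact: SC1'.
- move=> n /=; rewrite Sc' -[_ *: _]addr0 Sl S0 addr0 Sc scalerA mulrC//.
Qed.

Lemma multiplier_add a b s S s' S' : multiplier s S -> multiplier s' S' ->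
  multiplier (fun n => a * s n + b * s' n) (fun f => a *: S f + b *: S' f).
Proof.
move=> [Sl [C C0 [SC SC1]] Sc] [Sl' [C' C0' [SC' SC1']] Sc'].
split.
- move=> c f g /=; rewrite Sl' Sl !scalerDr !scalerA (mulrC a) (mulrC b) addrACA //.
- exists (`|a| * C + `|b| * C'); first by rewrite addr_ge0// mulr_ge0.
  split=> [f|f B fB x].
    by rewrite (le_trans (ler_normD _ _))// mulrDl lerD// normrZ -mulrA ler_wpM2l.
  rewrite holderDE !holderZE (le_trans (ler_normD _ _))// mulrDl lerD// normrM -mulrA ler_wpM2l//.
    exact: SC1.
  exact: SC1'.
- by move=> n; rewrite Sc Sc' !scalerA -scalerDl.
Qed.

Lemma multiplier_eq s s' S : s =1 s' -> multiplier s S -> multiplier s' S.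
Proof. by move=> ss [Sl SC Sc]; split=> // n; rewrite -ss. Qed.

Section Diagonal.
Variables (c : nat -> R) (C : R).
Hypothesis cC : forall n, `|c n| <= C / n.+1%:R ^+ 3.

Let C0 : 0 <= C.
Proof. by apply: (le_trans (normr_ge0 (c 0%N))); have := cC 0%N; rewrite expr1n divr1. Qed.

Let term (f : X) n : X := (c n * coef n f) *: hcos n.

Let term_le (f : X) B : (forall x, `|f x| <= B) ->
  forall n, `|term f n| <= (6 * C * B) * (n.+1%:R ^+ 2)^-1.
Proof.
move=> fB n; rewrite normrZ normrM.
have n0 : 0 < n.+1%:R :> R by rewrite ltr0n.
rewrite (_ : 6 * C * B * _ = (C / n.+1%:R ^+ 3 * (2 * B)) * (3 * n.+1%:R)); last first.
  by field; rewrite gt_eqF.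
apply: ler_pM => //.
  by rewrite ler_pM// coef_le.
by rewrite (le_trans (hcos_norm alpha01 n))// -natr1; have := ler0n R n; lra.
Qed.

Let term_cvg (f : X) B : (forall x, `|f x| <= B) ->
  cvgn (series (term f)) /\ `|limn (series (term f))| <= 12 * C * B.
Proof.
move=> fB; have B0 : 0 <= B by exact: le_trans (fB 0).
apply: (series_dominated (term_le fB)) => n.
rewrite (_ : series _ n = 6 * C * B * series (fun i => (i.+1%:R ^+ 2)^-1) n); last first.
  by rewrite !seriesEnat/= mulr_sumr.
rewrite (_ : 12 = 6 * 2)//; last by ring.
rewrite (_ : 6 * 2 * C * B = 6 * C * B * 2); last by ring.
by rewrite ler_wpM2l ?series_inv_sq// !mulr_ge0.
Qed.

Let term_cvgX (f : X) : cvgn (series (term f)).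
Proof. by have [] := @term_cvg f `|f| (holder_norm_ub f). Qed.

Definition diagonal (f : X) : X := limn (series (term f)).

(** The cubic decay of [c] pays for the linear growth of the Hoelder norm of
    [cos (n x)] and leaves a convergent series. *)
Lemma multiplier_diagonal : multiplier c diagonal.
Proof.
split.
- move=> a f g; rewrite /diagonal.
  apply: cvg_lim => //.
  rewrite (_ : series _ = fun n => a *: series (term f) n + series (term g) n).
    by apply: cvgD; [apply: cvgZl_tmp|]; exact: term_cvgX.
  apply/funext => n; rewrite !seriesEnat/= scaler_sumr -big_split/=.
  apply: eq_bigr => i _; rewrite /term coef_linear// mulrDr scalerDl.
  by rewrite mulrCA -[(a * _) *: _]scalerA.
- exists (12 * C); first by rewrite mulr_ge0.
  split=> [f|f B fB x]; first by have [] := @term_cvg f `|f| (holder_norm_ub f).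
  have [_ h] := term_cvg fB.
  exact: le_trans (holder_norm_ub _ _) h.
- move=> k; apply: lim_near_cst => //.
  exists k.+1 => // n /= kn.
  rewrite seriesEnat/= (bigD1_seq k) ?iota_uniq ?mem_index_iota//=.
  rewrite big1 ?addr0 => [|i ik]; rewrite /term coef_cos//.
    by rewrite eqxx mulr1.
  by rewrite (negbTE ik) mulr0 scale0r.
Qed.
End Diagonal.

Lemma multiplier_proj k : multiplier (fun n => (n == k)%:R) (fun f => coef k f *: hcos k).
Proof.
split.
- by move=> a f g; rewrite coef_linear// scalerDl scalerA.
- exists (2 * (k%:R + 3)); first by rewrite mulr_ge0.
  split=> [f|f B fB x].
    rewrite normrZ mulrAC ler_pM//; last exact: hcos_norm.
    by apply: coef_le => //; exact: holder_norm_ub.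
  have B0 : 0 <= B by exact: le_trans (fB 0).
  rewrite holderZE normrM mulrAC ler_pM//; first exact: coef_le.
  exact: le_trans (holder_norm_ub _ _) (hcos_norm _ _).
- move=> n; rewrite coef_cos// eq_sym.
  by case: eqVneq => [->//|_]; rewrite !scale0r.
Qed.

(** The truncated Neumann series of [1 / (mu - x)]. *)
Fixpoint neumann (mu x : R) j : R :=
  if j is i.+1 then mu^-1 * (1 + x * neumann mu x i) else 0.

Lemma multiplier_neumann mu j : exists S, multiplier (fun n => neumann mu (m n) j) S.
Proof.
elim: j => [|j [S mS]].
  exists (fun f => 0 *: f + 0 *: f).
  apply: multiplier_eq (multiplier_add 0 0 multiplier_id multiplier_id) => n.
  by rewrite /= !mul0r addr0.
exists (fun f => mu^-1 *: f + mu^-1 *: Lw (S f)).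
apply: multiplier_eq (multiplier_add mu^-1 mu^-1 multiplier_id
  (multiplier_comp multiplier_Lw mS)) => n.
by rewrite /= mulrDr mulr1.
Qed.

(** [Lw] only gains half a derivative, so its resolvent is not summable mode by
    mode; six Neumann steps leave a remainder of size [m n ^ 6 = O(n ^ -3)],
    which is. At a resonant mode [S] is [0]: the six Neumann steps produce [6 / mu]
    there, which the diagonal part removes. *)
Lemma multiplier_resolvent mu : 0 < mu ->
  exists S, multiplier (fun n => if m n == mu then 0 else (mu - m n)^-1) S.
Proof.
move=> mu0; have [d d0 gap] := @symbol_gap R mu mu0.
pose c n : R := if m n == mu then - (6 / mu) else m n ^+ 6 / (mu ^+ 6 * (mu - m n)).
pose C : R := (6 / mu ^+ 7 + (mu ^+ 6 * d)^-1) * 8.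
have c1 : 0 <= 6 / mu ^+ 7 by rewrite divr_ge0 ?exprn_ge0 ?(ltW mu0).
have c2 : 0 <= (mu ^+ 6 * d)^-1 by rewrite invr_ge0 mulr_ge0 ?exprn_ge0 ?(ltW mu0) ?(ltW d0).
have cC n : `|c n| <= C / n.+1%:R ^+ 3.
  rewrite -mulrA.
  apply: le_trans (ler_wpM2l (addr_ge0 c1 c2) (@symbol_pow6_le R n)).
  have m6 : 0 <= m n ^+ 6 by rewrite exprn_ge0// ltW// symbol_gt0.
  rewrite /c; case: eqVneq => [->|mn].
    rewrite normrN ger0_norm ?divr_ge0 ?(ltW mu0)// [leRHS]mulrDl.
    rewrite (_ : 6 / mu = 6 / mu ^+ 7 * mu ^+ 6); last by field; rewrite gt_eqF.
    by rewrite lerDl mulr_ge0// exprn_ge0// ltW.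
  rewrite normrM (ger0_norm m6) mulrC ler_wpM2r//.
  rewrite normfV normrM ger0_norm ?exprn_ge0 ?(ltW mu0)//.
  rewrite (@le_trans _ _ (mu ^+ 6 * d)^-1) ?lerDr//.
  have dn : 0 < `|mu - m n| by exact: lt_le_trans d0 (gap n mn).
  by rewrite lef_pV2 ?posrE ?mulr_gt0 ?exprn_gt0// ler_pM2l ?exprn_gt0// gap.
have [S mS] := multiplier_neumann mu 6.
exists (fun f => 1 *: S f + 1 *: diagonal c f).
apply: multiplier_eq (multiplier_add 1 1 mS (multiplier_diagonal cC)) => n.
rewrite /c !mul1r; case: eqVneq => [->|mn] /=; first by field; rewrite gt_eqF.
by field; rewrite (gt_eqF mu0) ?andbT /= subr_eq0 eq_sym.
Qed.

End Multipliers.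

(** * Multipliers and shorter periods *)

Section Periodicity.
Context {R : realType} {alpha : R}.
Hypothesis alpha01 : 0 < alpha < 1.
Notation X := (holder_even alpha).
Notation hcos := (@hcos R alpha).

Lemma dilation_subproof (a : R) (f : X) : 0 <= a -> periodic (fun x => f (a * x)) (pi *+ 2) ->
  (fun x => f (a * x)) \in holder_even_pred alpha.
Proof.
move=> a0 fp; rewrite inE; split=> // [x|]; first by rewrite mulrN; have [-> _ _] := holder_evenP f.
exists (`|f| * (1 + a `^ alpha)); split=> [x|x y].
  by rewrite (le_trans (holder_norm_ub _ _))// -holder_normE ler_peMr// lerDl powR_ge0.
apply: (le_trans (holder_norm_lip _ _ _)); rewrite -mulrBr normrM ger0_norm// powRM//.
by rewrite -holder_normE mulrA ler_wpM2r ?powR_ge0// ler_wpM2l// lerDr.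
Qed.

Definition dilation (a : R) (f : X) : X := insubd (0 : X) (fun x => f (a * x)).

Lemma dilationE (a : R) (f : X) x : 0 <= a -> periodic (fun x => f (a * x)) (pi *+ 2) ->
  dilation a f x = f (a * x).
Proof.
by move=> a0 fp; have /(congr1 (@^~ x)) := insubdK (0 : X) (dilation_subproof a0 fp).
Qed.

Lemma dilation_natE k (f : X) x : dilation k%:R f x = f (k%:R * x).
Proof.
apply: dilationE => // y; have [_ fp _] := holder_evenP f.
by rewrite mulrDr (mulr_natl (pi *+ 2)); exact: periodicn.
Qed.

(** Functions of period [2 pi / k] are dilations by [k], and on dilated cosines
    a multiplier acts by scalars; this avoids translations, which do not
    preserve evenness. *)
Lemma multiplier_periodic s (S : X -> X) k (f : X) : (0 < k)%N -> multiplier s S ->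
  periodic f (pi *+ 2 / k%:R) -> periodic (S f) (pi *+ 2 / k%:R).
Proof.
move=> k0 [Sl [C C0 [_ SC]] Sc] fp x; apply/eqP; rewrite -subr_eq0; apply/eqP.
have k00 : k%:R != 0 :> R by rewrite pnatr_eq0 -lt0n.
have ki : 0 <= k%:R^-1 :> R by rewrite invr_ge0.
have gp : periodic (fun x => f (k%:R^-1 * x)) (pi *+ 2).
  by move=> y; rewrite mulrDr [k%:R^-1 * (pi *+ 2)]mulrC fp.
have -> : f = dilation k%:R (dilation k%:R^-1 f).
  by apply: holder_even_ext => y; rewrite dilation_natE dilationE// mulKf.
apply: (@cos_ext _ _ alpha01 
  (fun g : X => S (dilation k%:R g) (x + pi *+ 2 / k%:R) - S (dilation k%:R g) x)
  (C + C)).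
- move=> a g h; rewrite (_ : dilation _ (a *: g + h) = a *: dilation k%:R g + dilation k%:R h).
    by rewrite Sl !holderDE !holderZE; ring.
  by apply: holder_even_ext => y; rewrite !(holderDE, holderZE) !dilation_natE.
- move=> g B gB; rewrite (le_trans (ler_normB _ _))// [leRHS]mulrDl lerD//; apply: SC => y;
    by rewrite dilation_natE.
- move=> n; rewrite (_ : dilation _ _ = hcos (n * k)); last first.
    by apply: holder_even_ext => y; rewrite dilation_natE !hcosE// natrM mulrA.
  rewrite Sc !holderZE !hcosE// mulrDr.
  rewrite (_ : (n * k)%:R * (pi *+ 2 / k%:R) = n%:R * (pi *+ 2)); last first.
    by rewrite natrM -mulrA [k%:R * _]mulrC divfK.
  by rewrite (mulr_natl (pi *+ 2)) (periodicn (@cosD2pi R)) subrr.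
Qed.

End Periodicity.

(** * Analyticity of power series with values in a Banach space *)

Section PowerSeries.
Context {R : realType}.

Lemma cvg_half_pow {V : normedModType R} (u : nat -> V) (l : V) C :
  (forall n, `|l - u n| <= C * 2^-1 ^+ n) -> u @ \oo --> l.
Proof.
move=> uC; apply/cvgrPdist_le => e e0.
have h : (fun n => C * 2^-1 ^+ n) @ \oo --> (0 : R).
  by rewrite -[X in _ --> X](mulr0 C); apply: cvgMl_tmp; apply: cvg_expr;
    rewrite ger0_norm ?invr_ge0// invf_lt1// ltr1n.
have /cvgrPdist_le/(_ _ e0) := h; apply: filterS => n.
rewrite sub0r normrN => hn; apply: le_trans (uC n) _; exact: le_trans (ler_norm _) hn.
Qed.

(** Splitting [2 ^ k = 2 ^ N * 2 ^ (k - N)] turns the tail of the binomial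
    expansion into a full expansion with [h] doubled. *)
Lemma binomial_tail (a h : R) n N :
  `|(a + h) ^+ n - \sum_(k < N) 'C(n, k)%:R * a ^+ (n - k) * h ^+ k|
    <= 2^-1 ^+ N * (`|a| + 2 * `|h|) ^+ n.
Proof.
have full (x y : R) P : (n < P)%N ->
    (x + y) ^+ n = \sum_(0 <= k < P) 'C(n, k)%:R * x ^+ (n - k) * y ^+ k.
  move=> nP; rewrite exprDn -(big_mkord xpredT (fun k => x ^+ (n - k) * y ^+ k *+ 'C(n, k))).
  rewrite (big_cat_nat (leq0n n.+1) nP)/= [X in _ = _ + X](_ : _ = 0) ?addr0.
    by apply: eq_bigr => k _; rewrite -mulr_natl mulrA.
  by apply: big1_seq => k; rewrite mem_index_iota => /andP[_ /andP[nk _]];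
    rewrite bin_small// !mul0r.
pose P := (n + N).+1.
have nP : (n < P)%N by rewrite ltnS leq_addr.
have NP : (N <= P)%N by rewrite ltnW// ltnS leq_addl.
rewrite (full _ _ _ nP) (full _ _ _ nP).
rewrite -(big_mkord xpredT (fun k => 'C(n, k)%:R * a ^+ (n - k) * h ^+ k)).
rewrite (big_cat_nat (leq0n N) NP)/= [X in X - _]addrC addrK.
rewrite (big_cat_nat (leq0n N) NP)/= mulrDr.
rewrite (le_trans (ler_norm_sum _ _ _))// ler_wpDl//.
  by rewrite mulr_ge0 ?exprn_ge0 ?invr_ge0// sumr_ge0// => k _; rewrite !mulr_ge0 ?exprn_ge0.
rewrite mulr_sumr ler_sum_nat// => k /andP[Nk _].
rewrite !normrM !normrX (ger0_norm (ler0n _ _)) exprMn [leRHS]mulrCA ler_wpM2l//.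
rewrite mulrA ler_peMl ?exprn_ge0//.
by rewrite exprVn -(subnK Nk) exprD mulrCA mulVf ?expf_neq0// mulr1 exprn_ege1// ler1n.
Qed.

Lemma binomial_term_le (x y : R) n k : 0 <= x -> 0 <= y ->
  'C(n, k)%:R * x ^+ (n - k) * y ^+ k <= (x + y) ^+ n.
Proof.
move=> x0 y0; have [nk|kn] := ltnP n k; first by rewrite bin_small// !mul0r exprn_ge0// addr_ge0.
rewrite -mulrA mulr_natl exprDn (bigD1 (Ordinal (n:=n.+1) (m:=k) kn))//= lerDl sumr_ge0// => i _.
by rewrite mulrn_wge0// mulr_ge0// exprn_ge0.
Qed.

Lemma cvg_sum_ord {V : normedModType R} (u : nat -> nat -> V) (l : nat -> V) N :
  (forall k, u k @ \oo --> l k) ->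
  (fun n => \sum_(k < N) u k n) @ \oo --> \sum_(k < N) l k.
Proof.
move=> ul; elim: N => [|N IH].
  rewrite big_ord0; under eq_fun do rewrite big_ord0; exact: cvg_cst.
rewrite big_ord_recr; under eq_fun do rewrite big_ord_recr.
by apply: cvgD.
Qed.

(** A convergent power series may be recentred: the partial sums of the new
    series differ from the sum by binomial tails only. The radius [1 / (8 r)]
    leaves room for the doubled increment [2 |h|] of those tails. *)
Lemma power_series_analytic {V : completeNormedModType R} (c : nat -> V) (f : R -> V) M r :
  0 < r -> (forall n, `|c n| <= M * r ^+ n) ->
  (forall e, `|e| * r <= 4^-1 -> series (fun n => e ^+ n *: c n) @ \oo --> f e) ->
  forall a, `|a| * r <= 8^-1 -> real_analytic_at f a.
Proof.
move=> r0 cM fE a ar.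
have M0 : 0 <= M by apply: (le_trans (normr_ge0 (c 0%N))); have := cM 0%N; rewrite mulr1.
(* [(|a| + h0) r <= 1 / 4], so each recentred coefficient is summable *)
pose h0 := (8 * r)^-1.
have h00 : 0 < h0 by rewrite invr_gt0 mulr_gt0.
have h0r : h0 * r = 8^-1 by rewrite /h0 invfM -mulrA mulVf ?mulr1// gt_eqF.
pose t k n : V := ('C(n, k)%:R * a ^+ (n - k)) *: c n.
have tcvg k : cvgn (series (t k)).
  have [] := @series_dominated _ _ (t k) (fun n => h0 ^- k * M * 2^-1 ^+ n) (h0 ^- k * M * 2).
  - move=> n; rewrite normrZ (@le_trans _ _ ((h0 ^- k * (`|a| + h0) ^+ n) * (M * r ^+ n)))//.
      apply: ler_pM => //.
      rewrite ler_pdivlMl ?exprn_gt0// normrM normrX ger0_norm// mulrC.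
      by apply: binomial_term_le => //; exact: ltW.
    rewrite mulrACA -exprMn ler_wpM2l//.
      by rewrite mulr_ge0// invr_ge0 exprn_ge0// ltW.
    rewrite lerXn2r ?nnegrE ?mulr_ge0 ?addr_ge0 ?(ltW h00) ?(ltW r0)//.
    by rewrite mulrDl h0r; move: ar; lra.
  - move=> n; rewrite (_ : series _ n = h0 ^- k * M * series (fun i => 2^-1 ^+ i) n); last first.
      by rewrite !seriesEnat/= mulr_sumr.
    by rewrite ler_wpM2l ?series_geometric_half// mulr_ge0// invr_ge0 exprn_ge0// ltW.
  by [].
pose b k := limn (series (t k)).
exists b; near=> e.
set h := e - a.
have hr : `|h| * r <= 8^-1.
  rewrite -ler_pdivlMr// /h distrC; near: e.
  by apply: cvgr_dist_le; [exact: cvg_id|rewrite divr_gt0// invr_gt0].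
have er : `|e| * r <= 4^-1.
  have : `|e| * r <= (`|h| + `|a|) * r.
    by rewrite ler_wpM2r ?(ltW r0)// -[e in `|e|](subrK a) ler_normD.
  by rewrite mulrDl; move: ar hr; lra.
apply: (@cvg_half_pow _ _ _ (M * 2)) => N.
have cN : series (fun n => (e ^+ n - \sum_(k < N) 'C(n, k)%:R * a ^+ (n - k) * h ^+ k) *: c n)
   @ \oo --> f e - series (fun n => h ^+ n *: b n) N.
  rewrite (_ : series _ = fun n => series (fun n => e ^+ n *: c n) n -
      \sum_(k < N) h ^+ k *: series (t k) n).
    apply: cvgB; first exact: fE.
    rewrite seriesEord/=; apply: (@cvg_sum_ord _
      (fun k n => h ^+ k *: series (t k) n) (fun k => h ^+ k *: b k)) => k.
    by apply: cvgZl_tmp; exact: tcvg.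
  apply/funext => n; rewrite !seriesEnat/=.
  rewrite (eq_bigr (fun k : 'I_N => \sum_(0 <= i < n) h ^+ k *: t k i)); last first.
    by move=> k _; rewrite -scaler_sumr.
  rewrite exchange_big -sumrB/=; apply: eq_bigr => i _.
  rewrite scalerBl scaler_suml; congr (_ - _); apply: eq_bigr => k _.
  by rewrite /t scalerA mulrC.
rewrite mulrAC; apply: (cvg_norm_le cN) => n.
apply: (@le_trans _ _ (\sum_(0 <= i < n) M * 2^-1 ^+ N * 2^-1 ^+ i)).
  rewrite seriesEnat/= (le_trans (ler_norm_sum _ _ _))// ler_sum// => i _.
  rewrite normrZ; have aB := binomial_tail a h i N.
  rewrite subrKC in aB.
  apply: le_trans (ler_pM _ _ aB (cM i)) _ => //.
  rewrite mulrACA (mulrC _ M).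
  rewrite ler_wpM2l ?mulr_ge0 ?exprn_ge0 ?invr_ge0// -exprMn.
  rewrite lerXn2r ?nnegrE ?mulr_ge0 ?addr_ge0 ?mulr_ge0 ?(ltW r0) ?invr_ge0//.
  by rewrite mulrDl; move: ar hr; nra.
rewrite -mulr_sumr ler_wpM2l ?mulr_ge0 ?exprn_ge0 ?invr_ge0//.
by have := @series_geometric_half R n; rewrite seriesEnat.
Unshelve. all: by end_near. Qed.

Lemma real_analytic_pair {V W : normedModType R} (f : R -> V) (g : R -> W) a :
  real_analytic_at f a -> real_analytic_at g a ->
  real_analytic_at (fun e => (f e, g e)) a.
Proof.
move=> [c fc] [d gd]; exists (fun n => (c n, d n)); near=> e.
rewrite (_ : series _ = fun n => (series (fun n => (e - a) ^+ n *: c n) n,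
  series (fun n => (e - a) ^+ n *: d n) n)).
  by apply: cvg_pair; near: e.
apply/funext => n; rewrite !seriesEnat/=.
elim: n => [|n IH]; first by rewrite !big_geq.
by rewrite !big_nat_recr//= IH.
Unshelve. all: by end_near. Qed.
End PowerSeries.

(** * Cauchy products for bounded bilinear maps *)

Section BoundedBilinear.
Context {R : realType}.

Definition bounded_linear {U V : normedModType R} (T : U -> V) (b : R) : Prop :=
  (forall a x y, T (a *: x + y) = a *: T x + T y) /\ forall x, `|T x| <= b * `|x|.

Definition bounded_bilinear {U V W : normedModType R} (B : U -> V -> W) (b : R) : Prop :=
  [/\ forall a x y z, B (a *: x + y) z = a *: B x z + B y z,
      forall a x y z, B x (a *: y + z) = a *: B x y + B x z
    & forall x y, `|B x y| <= b * (`|x| * `|y|)].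

Section LinearTheory.
Context {U V : normedModType R} (T : U -> V) (b : R) (HT : bounded_linear T b).

Lemma blin0 : T 0 = 0.
Proof.
have := HT.1 1 0 0; rewrite !scale1r add0r => /esym/eqP.
by rewrite -subr_eq0 addrK => /eqP.
Qed.

Lemma blinD x y : T (x + y) = T x + T y.
Proof. by have := HT.1 1 x y; rewrite !scale1r. Qed.

Lemma blinZ a x : T (a *: x) = a *: T x.
Proof. by have := HT.1 a x 0; rewrite blin0 !addr0. Qed.

Lemma blinB x y : T (x - y) = T x - T y.
Proof. by rewrite -scaleN1r blinD blinZ scaleN1r. Qed.

Lemma blin_sum I (r : seq I) (P : pred I) (F : I -> U) :
  T (\sum_(i <- r | P i) F i) = \sum_(i <- r | P i) T (F i).
Proof. exact: (big_morph T blinD blin0). Qed.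

End LinearTheory.

Section BilinearTheory.
Context {U V W : normedModType R} (B : U -> V -> W) (b : R) (HB : bounded_bilinear B b).

Lemma bilin_l y : bounded_linear (B ^~ y) (b * `|y|).
Proof.
have [Bl _ BB] := HB; split=> [a x z|x]; first exact: Bl.
by rewrite mulrAC -mulrA.
Qed.

Lemma bilin_r x : bounded_linear (B x) (b * `|x|).
Proof.
have [_ Br BB] := HB; split=> [a y z|y]; first exact: Br.
by rewrite -mulrA.
Qed.

Lemma bilin_le x y C D : `|x| <= C -> `|y| <= D -> `|B x y| <= `|b| * (C * D).
Proof.
move=> xC yD; have [_ _ BB] := HB; apply: (le_trans (BB x y)).
rewrite (@le_trans _ _ (`|b| * (`|x| * `|y|)))// ?ler_wpM2r ?ler_norm ?mulr_ge0//.
by rewrite ler_wpM2l// ler_pM.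
Qed.

Lemma bilin_dist x x' y y' :
  B x y - B x' y' = B (x - x') y + B x' (y - y').
Proof. by rewrite (blinB (bilin_l y)) (blinB (bilin_r x')) addrA subrK. Qed.

Lemma bilin_cvg (u : nat -> U) (v : nat -> V) x y :
  u @ \oo --> x -> v @ \oo --> y -> (fun n => B (u n) (v n)) @ \oo --> B x y.
Proof.
move=> ux vy.
have h1 : (fun n => `|b| * (`|x - u n| * `|y|)) @ \oo --> `|b| * (`|x - x| * `|y|).
  apply: cvgMl_tmp; apply: cvgMr_tmp; apply: cvg_norm; apply: cvgB => //; exact: cvg_cst.
have h2 : (fun n => `|b| * (`|u n| * `|y - v n|)) @ \oo --> `|b| * (`|x| * `|y - y|).
  apply: cvgMl_tmp; apply: cvgM; first exact: cvg_norm.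
  by apply: cvg_norm; apply: cvgB => //; exact: cvg_cst.
have h : (fun n => `|b| * (`|x - u n| * `|y|) + `|b| * (`|u n| * `|y - v n|))
    @ \oo --> (0 : R).
  rewrite [X in _ --> X](_ : _ = `|b| * (`|x - x| * `|y|) + `|b| * (`|x| * `|y - y|)).
    exact: cvgD h1 h2.
  by rewrite !subrr !normr0 mul0r !mulr0 addr0.
apply/cvgrPdist_le => e e0.
have /cvgrPdist_le/(_ _ e0) := h; apply: filterS => n.
rewrite sub0r normrN => hn; rewrite bilin_dist (le_trans (ler_normD _ _))//.
rewrite (le_trans _ hn)// (le_trans _ (ler_norm _))// lerD//; exact: bilin_le.
Qed.

Definition cauchy_prod (u : nat -> U) (v : nat -> V) n : W :=
  \sum_(i < n.+1) B (u i) (v (n - i)%N).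

Lemma triangle_sum (F : nat -> nat -> W) N :
  \sum_(n < N) \sum_(i < n.+1) F i (n - i)%N = \sum_(i < N) \sum_(j < N - i) F i j.
Proof.
elim: N => [|N IH]; first by rewrite !big_ord0.
rewrite big_ord_recr/= IH [RHS]big_ord_recr/= subSnn big_ord1.
rewrite [in LHS]big_ord_recr/= subnn addrA; congr (_ + _).
rewrite -big_split/=; apply: eq_bigr => i _.
by rewrite subSn ?(ltnW (ltn_ord i))// big_ord_recr.
Qed.

(** Mertens' theorem for geometrically decaying terms: the square of indices
    [i, j < N] exceeds the triangle [i + j < N] by terms of total size
    [O(2 ^ -N)]. *)
Lemma cauchy_prod_cvg (u : nat -> U) (v : nat -> V) M M' x y :
  (forall n, `|u n| <= M * 4^-1 ^+ n) -> (forall n, `|v n| <= M' * 4^-1 ^+ n) ->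
  series u @ \oo --> x -> series v @ \oo --> y ->
  series (cauchy_prod u v) @ \oo --> B x y.
Proof.
move=> uM vM ux vy.
have M0 : 0 <= M by apply: (le_trans (normr_ge0 (u 0%N))); have := uM 0%N; rewrite mulr1.
have M'0 : 0 <= M' by apply: (le_trans (normr_ge0 (v 0%N))); have := vM 0%N; rewrite mulr1.
have h1 := bilin_cvg ux vy.
suff h2 : (fun N => B (series u N) (series v N) - series (cauchy_prod u v) N) @ \oo --> (0 : W).
  have -> : series (cauchy_prod u v) = (fun N => B (series u N) (series v N)) -
      (fun N => B (series u N) (series v N) - series (cauchy_prod u v) N).
    by apply/funext => N; rewrite !fctE opprB addrC subrK.
  by rewrite -[B x y]subr0; exact: cvgB.
pose C := `|b| * (M * M') * 4.
apply: (@cvg_half_pow _ _ _ _ C) => N.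
rewrite sub0r normrN.
rewrite !seriesEord/= /cauchy_prod (triangle_sum (fun i j => B (u i) (v j))).
rewrite (blin_sum (bilin_l _)) -sumrB.
have row (i : 'I_N) : B (u i) (\sum_(k < N) v k) - \sum_(j < N - i) B (u i) (v j) =
    \sum_(N - i <= j < N) B (u i) (v j).
  rewrite (blin_sum (bilin_r _)) -(big_mkord xpredT (fun j => B (u i) (v j))).
  rewrite -(big_mkord xpredT (fun j => B (u i) (v j))).
  by rewrite (big_cat_nat (leq0n (N - i)) (leq_subr i N))/= addrC addrK.
rewrite (eq_bigr _ (fun i _ => row i)).
apply: (@le_trans _ _ (\sum_(i < N) \sum_(j < N)
    (`|b| * (M * M') * 2^-1 ^+ N) * (2^-1 ^+ i * 2^-1 ^+ j))).
  rewrite (le_trans (ler_norm_sum _ _ _))// ler_sum// => i _.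
  rewrite -(big_mkord xpredT (fun j => (`|b| * (M * M') * 2^-1 ^+ N) * (2^-1 ^+ i * 2^-1 ^+ j))).
  rewrite (big_cat_nat (leq0n (N - i)) (leq_subr i N))/=.
  rewrite (le_trans (ler_norm_sum _ _ _))// ler_wpDl//.
    by rewrite sumr_ge0// => k _; rewrite !mulr_ge0 ?exprn_ge0 ?invr_ge0.
  rewrite ler_sum_nat// => j /andP[Nij _].
  rewrite (le_trans (bilin_le (uM i) (vM j)))//.
  rewrite (mulrACA M) [leLHS]mulrA -[leRHS]mulrA ler_wpM2l ?mulr_ge0//.
  rewrite -[4^-1 ^+ i * _]exprD -[2^-1 ^+ i * _]exprD.
  rewrite (_ : 4^-1 = 2^-1 * 2^-1 :> R); last by field.
  rewrite exprMn ler_wpM2r ?exprn_ge0 ?invr_ge0//.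
  by rewrite ler_wiXn2l ?invr_ge0// ?invf_le1 ?ler1n// -leq_subLR.
under eq_bigr do rewrite -mulr_sumr -mulr_sumr.
rewrite -mulr_sumr -mulr_suml /C mulrAC ler_wpM2r ?exprn_ge0 ?invr_ge0//.
rewrite ler_wpM2l ?mulr_ge0//.
have g : 0 <= (\sum_(i < N) 2^-1 ^+ i : R) <= 2.
  rewrite sumr_ge0 => [|i _]; last by rewrite exprn_ge0// invr_ge0.
  by have := @series_geometric_half R N; rewrite seriesEord.
by move: g; nra.
Qed.
End BilinearTheory.

Lemma bounded_bilinear_comp {U V W Z : normedModType R} (T : W -> Z) (B : U -> V -> W) a b :
  0 <= a -> bounded_linear T a -> bounded_bilinear B b ->
  bounded_bilinear (fun x y => T (B x y)) (a * b).
Proof.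
move=> a0 HT [Bl Br BB]; split=> [c x y z|c x y z|x y].
- by rewrite Bl HT.1.
- by rewrite Br HT.1.
- by rewrite (le_trans (HT.2 _))// -mulrA ler_wpM2l.
Qed.

Lemma bounded_bilinear_le {U V W : normedModType R} (B : U -> V -> W) a b :
  a <= b -> bounded_bilinear B a -> bounded_bilinear B b.
Proof.
move=> ab [Bl Br BB]; split=> // x y.
by rewrite (le_trans (BB x y))// ler_wpM2r// mulr_ge0.
Qed.

Lemma bounded_linear_le {U V : normedModType R} (T : U -> V) a b :
  a <= b -> bounded_linear T a -> bounded_linear T b.
Proof.
move=> ab [Tl TB]; split=> // x; by rewrite (le_trans (TB x))// ler_wpM2r.
Qed.

End BoundedBilinear.

(** * Analytic solution of a cubic fixed point equation *)

Section AnalyticFixedPoint.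
Context {R : realType} {V : completeNormedModType R}.
Variables (B : V -> V -> V) (q : V -> V -> R) (T : V -> V) (b : R) (c : V).
Hypotheses (HB : bounded_bilinear B b) (Hq : bounded_bilinear q b) (HT : bounded_linear T b).

(** The model is [B u v = S (u v)], [q u v = p (u v)] and [T = S], for which
    [q w w] is the correction of the speed divided by [e]. *)
Definition cubic_map (w : V) : V := B w w - q w w *: T w.

Let E (s : R) (u : V) : V := s *: T u.

Let HE : bounded_bilinear E b.
Proof.
have [Tl TB] := HT; split=> [a x y z|a x y z|x y].
- by rewrite /E scalerDl -scalerA.
- by rewrite /E Tl scalerDr !scalerA (mulrC x).
- by rewrite /E normrZ mulrCA ler_wpM2l.
Qed.

(** Comparing powers of [e] in [w = c + e *: cubic_map w] determines the [n]-th
    coefficient from the previous ones; iterating this operator [n + 1] times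
    from any sequence stabilises the coefficients up to [n]. *)
Let coef_step (w : nat -> V) (n : nat) : V :=
  if n is n'.+1 then cauchy_prod B w w n' - cauchy_prod E (cauchy_prod q w w) w n' else c.

Definition fixpoint_coef n : V := iter n.+1 coef_step (fun=> 0) n.
Definition q_coef n : R := cauchy_prod q fixpoint_coef fixpoint_coef n.
Local Notation w := fixpoint_coef.
Local Notation eta := q_coef.

Let coef_step_local u v n : (forall i, (i < n)%N -> u i = v i) -> coef_step u n = coef_step v n.
Proof.
case: n => [//|n] uv /=; rewrite /cauchy_prod; congr (_ - _); apply: eq_bigr => i _.
  by rewrite !uv ?ltnS ?leq_subr// -ltnS.
congr (E _ _); last by rewrite uv// ltnS leq_subr.
apply: eq_bigr => j _; have ji : (j <= i)%N by rewrite -ltnS.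
have i_n : (i <= n)%N by rewrite -ltnS.
by rewrite !uv// ltnS; [exact: leq_trans (leq_subr _ _) i_n|exact: leq_trans i_n].
Qed.

Let iter_stable k n : (n < k)%N -> iter k coef_step (fun=> 0) n = w n.
Proof.
rewrite /w; elim/ltn_ind: n k => n IH [//|k]; rewrite ltnS => nk.
rewrite !iterS; apply: coef_step_local => i i_n.
by rewrite IH ?(leq_trans i_n)// [RHS]IH.
Qed.

Lemma fixpoint_coef0 : w 0%N = c. Proof. by []. Qed.

Lemma fixpoint_coefS n : w n.+1 = cauchy_prod B w w n - cauchy_prod E eta w n.
Proof.
rewrite {1}/fixpoint_coef iterS.
rewrite (@coef_step_local _ w)// => i i_n; exact: iter_stable.
Qed.

(** Transfers linear constraints on [c], such as a period, to the whole
    series. *)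
Lemma fixpoint_coef_closed (S : V -> Prop) :
  (forall a x y, S x -> S y -> S (a *: x + y)) -> S 0 -> S c ->
  (forall x y, S x -> S y -> S (B x y)) -> (forall x, S x -> S (T x)) ->
  forall n, S (w n).
Proof.
move=> Sl S0 Sc SB ST; elim/ltn_ind => -[//|n] IH; rewrite fixpoint_coefS.
have Ssum (F : nat -> V) k : (forall i, (i < k)%N -> S (F i)) -> S (\sum_(i < k) F i).
  elim: k => [|k IHk] SF; first by rewrite big_ord0.
  rewrite big_ord_recr/= addrC -[F k]scale1r; apply: Sl; first exact: SF.
  by apply: IHk => i ik; apply: SF; exact: ltnW.
rewrite addrC -scaleN1r; apply: (Sl (-1)).
  apply: (Ssum (fun i => E (eta i) (w (n - i)%N))) => i; rewrite ltnS => i_n.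
  rewrite -[E _ _]addr0; apply: Sl => //; apply: ST; apply: IH.
  by rewrite ltnS leq_subr.
apply: (Ssum (fun i => B (w i) (w (n - i)%N))) => i; rewrite ltnS => i_n.
by apply: SB; apply: IH; rewrite ltnS// leq_subr.
Qed.

(** By [1 / (x y) = (1 / x + 1 / y) / (x + y)] the convolution of two inverse
    squares is dominated by an average of the two. *)
Lemma inv_sq_conv n :
  \sum_(i < n.+1) ((i.+1%:R ^+ 2)^-1 * ((n - i).+1%:R ^+ 2)^-1) <= 8 / n.+1%:R ^+ 2 :> R.
Proof.
pose g i : R := (i.+1%:R ^+ 2)^-1.
have gs : \sum_(i < n.+1) g i <= 2.
  by have := @series_inv_sq R n.+1; rewrite seriesEord.
apply: (@le_trans _ _ (\sum_(i < n.+1) (2 / n.+1%:R ^+ 2) * (g i + g (n - i)%N))).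
  apply: ler_sum => i _; have i_n : (i <= n)%N by rewrite -ltnS.
  rewrite /g; set x : R := i.+1%:R; set y : R := (n - i).+1%:R.
  have xy : x + y = n.+1%:R + 1 by rewrite /x /y -natrD addSn addnS subnKC// -natr1.
  have x0 : 0 < x by rewrite ltr0n.
  have y0 : 0 < y by rewrite ltr0n.
  have z0 : 0 < n.+1%:R :> R by rewrite ltr0n.
  have -> : (x ^+ 2)^-1 + (y ^+ 2)^-1 = (x ^+ 2 + y ^+ 2) * ((x ^+ 2)^-1 * (y ^+ 2)^-1).
    by field; rewrite !gt_eqF.
  rewrite mulrA ler_peMl ?mulr_ge0 ?invr_ge0 ?exprn_ge0 ?(ltW x0) ?(ltW y0)//.
  rewrite mulrAC ler_pdivlMr ?exprn_gt0// mul1r.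
  move: (n.+1%:R : R) xy z0 => z xy z0.
  have : (z + 1) ^+ 2 <= 2 * (x ^+ 2 + y ^+ 2).
    by rewrite -xy; have := sqr_ge0 (x - y); nra.
  by nra.
rewrite -mulr_sumr big_split/=.
rewrite [X in _ + X](_ : _ = \sum_(i < n.+1) g i); last first.
  by rewrite (reindex_inj rev_ord_inj)/=; apply: eq_bigr => i _; rewrite subSS subKn// -ltnS.
have z0 : 0 <= 2 / n.+1%:R ^+ 2 :> R by rewrite divr_ge0.
rewrite (_ : 8 / _ = 2 / n.+1%:R ^+ 2 * (2 + 2)); last by rewrite mulrAC; congr (_ / _); ring.
by rewrite ler_wpM2l// lerD.
Qed.

Let cauchy_prod_le (U1 U2 U3 : normedModType R) (F : U1 -> U2 -> U3) u v A A' r n :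
  bounded_bilinear F b ->
  0 < r ->
  (forall i, (i <= n)%N -> `|u i| <= A * r ^+ i / i.+1%:R ^+ 2) ->
  (forall i, (i <= n)%N -> `|v i| <= A' * r ^+ i / i.+1%:R ^+ 2) ->
  `|cauchy_prod F u v n| <= 8 * `|b| * A * A' * r ^+ n / n.+1%:R ^+ 2.
Proof.
move=> HF r0 uA vA.
have A0 : 0 <= A by have := le_trans (normr_ge0 _) (uA 0%N isT); rewrite mulr1 expr1n divr1.
have A'0 : 0 <= A' by have := le_trans (normr_ge0 _) (vA 0%N isT); rewrite mulr1 expr1n divr1.
rewrite (le_trans (ler_norm_sum _ _ _))//.
apply: (@le_trans _ _ (\sum_(i < n.+1) 
    (`|b| * A * A' * r ^+ n) * ((i.+1%:R ^+ 2)^-1 * ((n - i).+1%:R ^+ 2)^-1))).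
  apply: ler_sum => i _; have i_n : (i <= n)%N by rewrite -ltnS.
  apply: (le_trans (bilin_le HF (uA _ i_n) (vA _ (leq_subr i n)))).
  rewrite mulrACA [X in _ <= _ * X * _](_ : _ = r ^+ i * r ^+ (n - i)); last first.
    by rewrite -exprD subnKC.
  by rewrite (mulrACA A) !mulrA.
rewrite -mulr_sumr.
rewrite (_ : 8 * _ * _ * _ * _ / _ = `|b| * A * A' * r ^+ n * (8 / n.+1%:R ^+ 2)); last first.
  by rewrite -!mulrA (mulrC 8) -!mulrA; do 4 congr (_ * _); rewrite mulrC.
by rewrite ler_wpM2l ?inv_sq_conv// !mulr_ge0// exprn_ge0// ltW.
Qed.

Let M : R := `|c| + 1.
Let k0 : R := 8 * `|b| * M + 64 * `|b| ^+ 2 * M ^+ 2.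
(** The constant [k0] bounds the quadratic and cubic terms of the recursion at
    size [M]; the factor [4] pays for the shift from [n + 1] to [n + 2] in the
    weight. *)
Definition growth : R := 1 + 4 * k0.
Local Notation r := growth.

Let M_gt0 : 0 < M. Proof. by rewrite ltr_wpDl. Qed.
Let k0_ge0 : 0 <= k0.
Proof. by rewrite addr_ge0// !mulr_ge0// ?exprn_ge0// ltW. Qed.

Lemma growth_ge1 : 1 <= r. Proof. by rewrite lerDl mulr_ge0. Qed.
Let r_gt0 : 0 < r. Proof. exact: lt_le_trans growth_ge1. Qed.

(** The weight [1 / (n + 1) ^ 2] is stable under Cauchy products up to a
    constant, which the choice of [growth] absorbs. *)
Let coef_le n : `|w n| <= M * r ^+ n / n.+1%:R ^+ 2.
Proof.
elim/ltn_ind: n => -[_|n IH].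
  by rewrite fixpoint_coef0 mulr1 expr1n divr1 lerDl.
have {}IH i : (i <= n)%N -> `|w i| <= M * r ^+ i / i.+1%:R ^+ 2.
  by move=> i_n; exact: IH.
rewrite fixpoint_coefS (le_trans (ler_normB _ _))//.
have h1 := cauchy_prod_le HB r_gt0 IH IH.
have heta i : (i <= n)%N -> `|eta i| <= 8 * `|b| * M * M * r ^+ i / i.+1%:R ^+ 2.
  move=> i_n; apply: (cauchy_prod_le Hq r_gt0) => j ji; apply: IH; exact: leq_trans i_n.
have h2 := cauchy_prod_le HE r_gt0 heta IH.
apply: le_trans (lerD h1 h2) _.
rewrite (_ : _ + _ = M * r ^+ n * (k0 / n.+1%:R ^+ 2)); last first.
  by rewrite /k0 -!mulrDl -!mulrA [RHS]mulrA !mulrA; congr (_ / _); ring.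
rewrite (exprSr r n) [M * (_ * _)]mulrA -[leRHS]mulrA ler_wpM2l ?mulr_ge0 ?exprn_ge0 ?(ltW M_gt0) ?(ltW r_gt0)//.
rewrite ler_pdivlMr ?exprn_gt0// mulrAC ler_pdivrMr ?exprn_gt0//.
rewrite (@le_trans _ _ (k0 * (4 * n.+1%:R ^+ 2)))//.
  rewrite ler_wpM2l// -[n.+2%:R]natr1; have : 1 <= n.+1%:R :> R by rewrite ler1n.
  by move: (n.+1%:R : R) => z z1; nra.
by rewrite mulrA ler_wpM2r ?exprn_ge0// mulrC lerDr.
Qed.

Let weight_le (x : R) n : 0 <= x -> x / n.+1%:R ^+ 2 <= x.
Proof.
by move=> x0; rewrite ler_piMr// invf_le1 ?exprn_gt0// exprn_ege1// ler1n.
Qed.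

Lemma fixpoint_coef_le n : `|w n| <= (`|c| + 1) * r ^+ n.
Proof.
by rewrite (le_trans (coef_le n))// weight_le// mulr_ge0// ?exprn_ge0// ltW.
Qed.

Definition q_coef_bound : R := 8 * `|b| * (`|c| + 1) * (`|c| + 1).

Lemma q_coef_le n : `|eta n| <= q_coef_bound * r ^+ n.
Proof.
apply: (le_trans (cauchy_prod_le (A := M) (A' := M) Hq r_gt0 _ _)) => [i _|i _|]; [exact: coef_le..|].
by rewrite weight_le// !mulr_ge0 ?exprn_ge0// ?ltW.
Qed.

Definition fixpoint_sum (e : R) : V := limn (series (fun n => e ^+ n *: w n)).

Let scaled_le {U : normedModType R} (u : nat -> U) A e n :
  (forall n, `|u n| <= A * r ^+ n) -> `|e| * r <= 4^-1 -> `|e ^+ n *: u n| <= A * 4^-1 ^+ n.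
Proof.
move=> uA er; have A0 : 0 <= A by have := le_trans (normr_ge0 _) (uA 0%N); rewrite mulr1.
rewrite normrZ normrX (le_trans (ler_wpM2l _ (uA n))) ?exprn_ge0//.
rewrite mulrCA -exprMn ler_wpM2l//.
by rewrite lerXn2r ?nnegrE ?mulr_ge0 ?invr_ge0// ltW.
Qed.

Let series_quarter n : series (fun i => 4^-1 ^+ i) n <= 2 :> R.
Proof.
apply: le_trans (@series_geometric_half R n); rewrite !seriesEnat/=.
apply: ler_sum => i _; rewrite lerXn2r ?nnegrE ?invr_ge0//.
by rewrite lef_pV2 ?posrE// ler_nat.
Qed.

Let sum_spec e : `|e| * r <= 4^-1 ->
  cvgn (series (fun n => e ^+ n *: w n)) /\ `|fixpoint_sum e| <= (`|c| + 1) * 2.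
Proof.
move=> er; apply: (series_dominated (b := fun n => (`|c| + 1) * 4^-1 ^+ n)) => n.
  exact: scaled_le fixpoint_coef_le er.
rewrite (_ : series _ n = (`|c| + 1) * series (fun i => 4^-1 ^+ i) n).
  by rewrite ler_wpM2l// addr_ge0.
by rewrite !seriesEnat/= mulr_sumr.
Qed.

Lemma fixpoint_sum_cvg e : `|e| * r <= 4^-1 ->
  series (fun n => e ^+ n *: w n) @ \oo --> fixpoint_sum e.
Proof. by move=> /sum_spec[]. Qed.

Lemma fixpoint_sum_le e : `|e| * r <= 4^-1 -> `|fixpoint_sum e| <= (`|c| + 1) * 2.
Proof. by move=> /sum_spec[]. Qed.

Let scaled_cauchy {U1 U2 U3 : normedModType R} (F : U1 -> U2 -> U3) bF u v e n :
  bounded_bilinear F bF ->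
  cauchy_prod F (fun n => e ^+ n *: u n) (fun n => e ^+ n *: v n) n =
  e ^+ n *: cauchy_prod F u v n.
Proof.
move=> HF; rewrite /cauchy_prod scaler_sumr; apply: eq_bigr => i _.
have i_n : (i <= n)%N by rewrite -ltnS.
rewrite (blinZ (bilin_l HF _)) (blinZ (bilin_r HF _)) scalerA.
by rewrite -exprD subnKC.
Qed.

Lemma q_series_cvg e : `|e| * r <= 4^-1 ->
  series (fun n => e ^+ n *: (eta n : R^o)) @ \oo --> q (fixpoint_sum e) (fixpoint_sum e).
Proof.
move=> er; have wl n := @scaled_le _ w _ e n fixpoint_coef_le er.
have := cauchy_prod_cvg Hq wl wl (fixpoint_sum_cvg er) (fixpoint_sum_cvg er).
rewrite (_ : cauchy_prod _ _ _ = fun n => e ^+ n *: (eta n : R^o))//.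
by apply/funext => n; rewrite (scaled_cauchy w w e n Hq).
Qed.

Lemma fixpoint_sumE e : `|e| * r <= 4^-1 ->
  fixpoint_sum e = c + e *: cubic_map (fixpoint_sum e).
Proof.
move=> er; have wl n := @scaled_le _ w _ e n fixpoint_coef_le er.
have el n := @scaled_le _ eta _ e n q_coef_le er.
have wc := fixpoint_sum_cvg er.
have h1 := cauchy_prod_cvg HB wl wl wc wc.
have h2 := cauchy_prod_cvg HE el wl (q_series_cvg er) wc.
have h3 : (fun n => series (fun n => e ^+ n *: w n) n.+1) @ \oo --> fixpoint_sum e.
  by have := wc; rewrite -(cvg_shiftS (series (fun n => e ^+ n *: w n))).
have h4 : (fun n => series (fun n => e ^+ n *: w n) n.+1) @ \oo -->
    c + e *: cubic_map (fixpoint_sum e).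
  rewrite (_ : (fun n => series _ n.+1) = fun n => c + e *: (series
      (cauchy_prod B (fun n => e ^+ n *: w n) (fun n => e ^+ n *: w n)) n -
      series (cauchy_prod E (fun n => e ^+ n *: (eta n : R^o)) (fun n => e ^+ n *: w n)) n)).
    apply: cvgD; first exact: cvg_cst.
    by apply: cvgZl_tmp; exact: (cvgB h1 h2).
  apply/funext => n; rewrite !seriesEord/= big_ord_recl expr0 scale1r fixpoint_coef0.
  congr (_ + _); rewrite -sumrB scaler_sumr; apply: eq_bigr => i _.
  rewrite (scaled_cauchy w w e i HB) (scaled_cauchy eta w e i HE).
  by rewrite -scalerBr -fixpoint_coefS scalerA -exprS.
exact: (cvg_unique _ h3 h4).
Qed.

Definition cubic_lip (D : R) : R := 2 * `|b| * D + 3 * `|b| ^+ 2 * D ^+ 2.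

Lemma cubic_map_dist D x y : `|x| <= D -> `|y| <= D ->
  `|cubic_map x - cubic_map y| <= cubic_lip D * `|x - y|.
Proof.
move=> xD yD; have D0 : 0 <= D by exact: le_trans xD.
rewrite /cubic_map /cubic_lip.
rewrite (_ : _ - _ = (B x x - B y y) - (E (q x x) x - E (q y y) y)); last first.
  by rewrite !opprB addrACA [X in _ = X]addrACA; congr (_ + _); rewrite addrC.
rewrite (le_trans (ler_normB _ _))// mulrDl lerD//.
  rewrite (bilin_dist HB) (le_trans (ler_normD _ _))//.
  rewrite (_ : 2 * `|b| * D * _ = `|b| * (`|x - y| * D) + `|b| * (D * `|x - y|)); last by ring.
  by rewrite lerD//; exact: (bilin_le HB).
rewrite (bilin_dist HE) (le_trans (ler_normD _ _))//.
rewrite (_ : 3 * `|b| ^+ 2 * D ^+ 2 * _ =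
  `|b| * ((`|b| * (`|x - y| * D) + `|b| * (D * `|x - y|)) * D) + `|b| * ((`|b| * (D * D)) * `|x - y|)); last by ring.
rewrite lerD//; apply: (bilin_le HE) => //.
  rewrite (bilin_dist Hq) (le_trans (ler_normD _ _))//.
  by rewrite lerD//; exact: (bilin_le Hq).
exact: (bilin_le Hq).
Qed.

(** Two solutions differ by a strict contraction of their difference. *)
Lemma fixpoint_unique D e x y : `|x| <= D -> `|y| <= D -> `|e| * cubic_lip D < 1 ->
  x = c + e *: cubic_map x -> y = c + e *: cubic_map y -> x = y.
Proof.
move=> xD yD eL xE yE; apply/eqP; rewrite -subr_eq0 -normr_le0.
have : `|x - y| <= `|e| * cubic_lip D * `|x - y|.
  rewrite {1}xE {1}yE opprD addrACA subrr add0r -scalerBr normrZ -mulrA ler_wpM2l//.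
  exact: cubic_map_dist.
have := normr_ge0 (x - y); move: (`|x - y|) => d d0.
by rewrite -subr_le0 -[X in X - _]mul1r -mulrBl pmulr_rle0// subr_gt0.
Qed.

Lemma fixpoint_sum_near e : `|e| * r <= 4^-1 ->
  `|fixpoint_sum e - c| <= `|e| * (cubic_lip ((`|c| + 1) * 2) * ((`|c| + 1) * 2)).
Proof.
move=> er; have WD := fixpoint_sum_le er; rewrite {1}(fixpoint_sumE er) addrC addKr.
rewrite normrZ ler_wpM2l//.
have D0 : 0 <= (`|c| + 1) * 2 by exact: le_trans WD.
have c0 : cubic_map 0 = 0.
  by rewrite /cubic_map (blin0 (bilin_r HB _)) (blin0 HT) scaler0 subr0.
have := @cubic_map_dist _ _ 0 WD; rewrite normr0 c0 !subr0 => /(_ D0) h.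
rewrite (le_trans h)// ler_wpM2l// addr_ge0// !mulr_ge0// exprn_ge0//.
Qed.

End AnalyticFixedPoint.

(** * Lyapunov-Schmidt reduction *)

Section Bifurcation.
Context {R : realType} {alpha : R} {K : R -> R}.
Hypothesis alpha01 : 0 < alpha < 1.
Hypothesis hK : is_whitham_kernel K.
Notation X := (holder_even alpha).
Notation hcos := (@hcos R alpha).
Notation Lw := (@Lw R alpha K).
Local Notation m n := (@whitham_symbol R n%:R).

Let solE := whitham_solutionE alpha01 hK.

Lemma hmul_bilinear : bounded_bilinear (@hmul R alpha) 3.
Proof.
split=> [a x y z|a x y z|x y]; last exact: hmul_norm.
- by rewrite hmulDl hmulZl.
- by rewrite hmulC hmulDl hmulZl !(hmulC x).
Qed.

Lemma coef_bounded k : bounded_linear (@coef R alpha k : X -> R) 2.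
Proof.
split=> [a x y|x]; first exact: coef_linear.
by apply: coef_le => //; exact: holder_norm_ub.
Qed.

Lemma multiplier_bounded s (S : X -> X) : multiplier s S ->
  exists2 C : R, 0 <= C & bounded_linear S C.
Proof. by move=> [Sl [C C0 [SC _]] _]; exists C. Qed.

(** The radius [1 / (8 (C + 1))] is chosen so that the quadratic term and the
    detuning together are absorbed with a factor [1 / 2]. *)
Lemma half_absorbed (C p d : R) : 0 <= C ->
  p < (8 * (C + 1))^-1 -> d < (8 * (C + 1))^-1 -> C * (3 * p + d) <= 2^-1.
Proof.
move=> C0 pC dC; have C1 : 0 < C + 1 by rewrite ltr_wpDl.
have : 3 * p + d <= 4 * (8 * (C + 1))^-1 by lra.
move=> /(ler_wpM2l C0) h; apply: (le_trans h).
rewrite (_ : C * _ = C / (C + 1) * 2^-1); last by field; rewrite gt_eqF.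
by rewrite ler_piMl ?invr_ge0// ler_pdivrMr// mul1r lerDl.
Qed.

(** A small solution at a nonresonant speed is a fixed point of a contraction
    that vanishes at the origin. *)
Lemma nonresonant_trivial (mu : R) : 0 < mu -> (forall n, m n != mu) ->
  exists2 rho : R, 0 < rho & forall (psi : X) nu, `|psi| < rho -> `|nu - mu| < rho ->
    whitham_solution K psi nu -> psi = 0.
Proof.
move=> mu0 nres; have [S mS] := multiplier_resolvent alpha01 hK mu0.
have [C C0 HS] := multiplier_bounded mS.
have SE psi : S (mu *: psi - Lw psi) = psi.
  have h := multiplier_comp mS (multiplier_add mu (-1) (@multiplier_id R alpha) (multiplier_Lw alpha01 hK)).
  have h1 n : (if m n == mu then 0 else (mu - m n)^-1) * (mu * 1 + -1 * m n) = 1.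
    by rewrite (negbTE (nres n)) mulr1 mulN1r mulVf// subr_eq0 eq_sym.
  by have := multiplier_ext alpha01 h (@multiplier_id R alpha) h1 psi; rewrite /= scaleN1r.
exists (8 * (C + 1))^-1; first by rewrite invr_gt0 mulr_gt0// ltr_wpDl.
move=> psi nu psi_lt nu_lt /solE sol.
have E : psi = S (hmul psi psi - (nu - mu) *: psi).
  rewrite -[LHS]SE -sol; congr S.
  by apply: holder_even_ext => x; rewrite !(holderBE, holderDE, holderZE); ring.
apply/eqP; rewrite -normr_le0.
have le : `|psi| <= C * ((3 * `|psi| + `|nu - mu|) * `|psi|).
  rewrite {1}E (le_trans (HS.2 _))// ler_wpM2l// (le_trans (ler_normB _ _))// mulrDl lerD//.
    by rewrite -mulrA hmul_norm.
  by rewrite normrZ.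
have c1 := half_absorbed C0 psi_lt nu_lt.
have := normr_ge0 psi; move: c1 le; rewrite mulrA.
by move: (`|psi|) (C * _) => p x; nra.
Qed.

Section AtMode.
Variable k : nat.
Variables (S : X -> X) (C : R).
Hypothesis mS : multiplier (fun n => if m n == m k then 0 else (m k - m n)^-1) S.
Hypothesis C0 : 0 <= C.
Hypothesis HS : bounded_linear S C.

Let c : X := hcos k.
Let b : R := C * 3 + C + 6.
Let B (u v : X) : X := S (hmul u v).
Let q (u v : X) : R := coef k (hmul u v).

Let b0 : 0 <= b. Proof. by rewrite !addr_ge0// mulr_ge0. Qed.

Let HB : bounded_bilinear B b.
Proof.
apply: bounded_bilinear_le (bounded_bilinear_comp C0 HS hmul_bilinear).
by rewrite /b -addrA lerDl addr_ge0.
Qed.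

Let Hq : bounded_bilinear (q : X -> X -> R) b.
Proof.
apply: bounded_bilinear_le (bounded_bilinear_comp _ (coef_bounded k) hmul_bilinear) => //.
by rewrite /b; have := C0; lra.
Qed.

Let HT : bounded_linear S b.
Proof. by apply: bounded_linear_le HS; rewrite /b; have := C0; lra. Qed.

Let resE n : (m n == m k) = (n == k).
Proof. by apply/eqP/eqP => [/symbol_inj|->]. Qed.

Let mE := multiplier_add 1 (-1) (@multiplier_id R alpha) (multiplier_proj alpha01 k).
Let mL := multiplier_add (m k) (-1) (@multiplier_id R alpha) (multiplier_Lw alpha01 hK).

Let mulE n : (if m n == m k then 0 else (m k - m n)^-1) * (m k * 1 + -1 * m n) =
  1 * 1 + -1 * (n == k)%:R.
Proof.
rewrite resE; have [->|nk] := eqVneq n k; first by rewrite mul0r mulr1 mulN1r subrr.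
by rewrite !mulr1 mulr0 addr0 mulN1r mulVf// subr_eq0 eq_sym resE.
Qed.

Lemma resolvent_left psi : S (m k *: psi - Lw psi) = psi - coef k psi *: c.
Proof.
have /(_ psi) := multiplier_ext alpha01 (multiplier_comp mS mL) mE mulE.
by rewrite /= !scaleN1r scale1r.
Qed.

Lemma resolvent_right psi : m k *: S psi - Lw (S psi) = psi - coef k psi *: c.
Proof.
have mulE' n := etrans (mulrC _ _) (mulE n).
have /(_ psi) := multiplier_ext alpha01 (multiplier_comp mL mS) mE mulE'.
by rewrite /= !scaleN1r scale1r.
Qed.

Lemma coefZ a (f : X) : coef k (a *: f) = a * coef k f.
Proof. exact: (blinZ (coef_bounded k)). Qed.

Lemma coef_hcos a : coef k (a *: c) = a.
Proof. by rewrite coefZ coef_cos// eqxx mulr1. Qed.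

Lemma coef_resolvent psi : coef k (S psi) = 0.
Proof.
have m0 := multiplier_add 0 0 (@multiplier_id R alpha) (@multiplier_id R alpha).
have z n : (n == k)%:R * (if m n == m k then 0 else (m k - m n)^-1) = 0 * 1 + 0 * 1 :> R.
  by rewrite !mul0r addr0 resE; case: eqP => _; rewrite ?mulr0 ?mul0r.
have := multiplier_ext alpha01 (multiplier_comp (multiplier_proj alpha01 k) mS) m0 z psi.
rewrite /= !scale0r addr0 => h; rewrite -[LHS]coef_hcos h.
exact: (blin0 (coef_bounded k)).
Qed.

Lemma coef_Lw psi : coef k (Lw psi) = m k * coef k psi.
Proof.
have mP := multiplier_proj alpha01 k.
have z n : (n == k)%:R * m n = m k * (n == k)%:R + 0 * 1.
  by rewrite mul0r addr0; case: eqP => [->|_]; rewrite ?mulr1 ?mul1r ?mulr0 ?mul0r.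
have := multiplier_ext alpha01 (multiplier_comp mP (multiplier_Lw alpha01 hK))
  (multiplier_add (m k) 0 mP (@multiplier_id R alpha)) z psi.
rewrite /= scale0r addr0 scalerA => h.
by rewrite -[LHS]coef_hcos h coef_hcos.
Qed.

Lemma resolvent_mode : S c = 0.
Proof. by have [_ _ ->] := mS; rewrite eqxx scale0r. Qed.

Local Notation G := (cubic_map B q S).

(** Lyapunov--Schmidt reduction in the unknown [w = phi / e]: projecting on
    the kernel gives [mu = m k + e * q w w], and inverting on the complement
    gives the fixed point equation. *)
Lemma reduction_sound e (w : X) : w = c + e *: G w ->
  whitham_solution K (e *: w) (m k + e * q w w).
Proof.
move=> wE; apply/solE.
have cw : coef k w = 1.
  rewrite wE (blinD (coef_bounded k)) coefZ /cubic_map (blinB (coef_bounded k)).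
  by rewrite coefZ /B !coef_resolvent mulr0 subrr mulr0 addr0 /c coef_cos// eqxx.
have LD := multiplier_bounded (multiplier_Lw alpha01 hK); case: LD => CL _ HL.
have key : m k *: w - Lw w = e *: (hmul w w - q w w *: w).
  rewrite {1 2}wE (blinD HL) (blinZ HL) /cubic_map (blinB HL) (blinZ HL).
  rewrite /c Lw_cos//.
  have := resolvent_right (hmul w w); have := resolvent_right w; rewrite cw scale1r.
  rewrite -/(q w w) -/(B w w); set Lb := Lw (B w w); set Ls := Lw (S w).
  move=> /eqP; rewrite subr_eq => /eqP h1 /eqP; rewrite subr_eq => /eqP h2.
  rewrite scalerDr opprD addrACA subrr add0r scalerA (mulrC _ e) -scalerA -scalerBr.
  congr (_ *: _); rewrite scalerBr scalerA (mulrC (m k)) -scalerA h1 h2.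
  rewrite /c; apply: holder_even_ext => x; rewrite !(holderBE, holderDE, holderZE); ring.
rewrite hmulZl hmulC hmulZl (blinZ HL).
have -> : Lw w = m k *: w - e *: (hmul w w - q w w *: w) by rewrite -key opprB addrC subrK.
by apply: holder_even_ext => x; rewrite !(holderBE, holderDE, holderZE); ring.
Qed.

(** The projection yields the speed, and applying [S] the fixed point
    equation. *)
Lemma reduction_complete (psi : X) nu : whitham_solution K psi nu -> coef k psi != 0 ->
  let e := coef k psi in let w := e^-1 *: psi in
  w = c + e *: G w /\ nu = m k + e * q w w.
Proof.
move=> /solE sol e0 e w.
have LD := multiplier_bounded (multiplier_Lw alpha01 hK); case: LD => CL _ HL.
have psiE : psi = e *: w by rewrite /w scalerA mulfV// scale1r.
have qE : coef k (hmul psi psi) = e ^+ 2 * q w w.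
  by rewrite psiE hmulZl hmulC hmulZl !coefZ mulrA.
have nuE : nu - m k = e * q w w.
  apply: (mulIf e0); rewrite (_ : e * q w w * _ = e ^+ 2 * q w w); last by rewrite -/e; ring.
  rewrite -qE -sol.
  by rewrite (blinB (coef_bounded k)) coefZ coef_Lw mulrBl.
split; last by rewrite -nuE addrC subrK.
have h : psi - e *: c + (nu - m k) *: S psi = S (hmul psi psi).
  rewrite -resolvent_left -(blinZ HS) -(blinD HS) -sol; congr S.
  by apply: holder_even_ext => x; rewrite !(holderBE, holderDE, holderZE); ring.
have {}h : psi = e *: c + S (hmul psi psi) - (nu - m k) *: S psi.
  by rewrite -h; apply: holder_even_ext => x; rewrite !(holderBE, holderDE, holderZE); ring.
have wE : w = e^-1 *: psi by [].
clearbody w; rewrite {1}wE {1}h nuE psiE hmulZl hmulC hmulZl !(blinZ HS) /cubic_map -/(B w w).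
apply: holder_even_ext => x; rewrite !(holderBE, holderDE, holderZE).
by field.
Qed.

(** The component off the kernel is of second order, so a small solution is
    controlled by its coefficient on the kernel. *)
Lemma small_solution_mode (psi : X) nu : `|psi| < (8 * (C + 1))^-1 ->
  `|nu - m k| < (8 * (C + 1))^-1 ->
  whitham_solution K psi nu -> `|psi| <= 2 * `|c| * `|coef k psi|.
Proof.
move=> psi_lt nu_lt /solE sol; set e := coef k psi.
have h : psi = e *: c + S (hmul psi psi - (nu - m k) *: psi).
  rewrite -sol; have := resolvent_left psi.
  rewrite (_ : nu *: psi - _ - _ = m k *: psi - Lw psi); first by move=> ->; rewrite addrC subrK.
  by apply: holder_even_ext => x; rewrite !(holderBE, holderDE, holderZE); ring.
have le : `|psi| <= `|e| * `|c| + C * ((3 * `|psi| + `|nu - m k|) * `|psi|).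
  rewrite {1}h (le_trans (ler_normD _ _))// normrZ lerD// (le_trans (HS.2 _))//.
  rewrite ler_wpM2l// (le_trans (ler_normB _ _))// mulrDl lerD//.
    by rewrite -mulrA hmul_norm.
  by rewrite normrZ.
have c1 := half_absorbed C0 psi_lt nu_lt.
have := normr_ge0 psi; move: c1 le; rewrite mulrA (mulrC `|e|) -(mulrA 2).
by move: (`|psi|) (C * _) (_ * `|e|) => p x y; nra.
Qed.

Local Notation r := (growth b c).
Local Notation W := (fixpoint_sum B q S c).
Let D : R := (`|c| + 1) * 2.
Let D0 : 0 <= D. Proof. by rewrite mulr_ge0// addr_ge0. Qed.
Let lip0 : 0 <= cubic_lip b D.
Proof. by rewrite addr_ge0// !mulr_ge0// exprn_ge0. Qed.
Let r0 : 0 < r. Proof. by rewrite (lt_le_trans ltr01)// growth_ge1. Qed.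

Definition branch_phi (e : R) : X := e *: W e.
Definition branch_mu (e : R) : R := m k + e * q (W e) (W e).
Definition branch_radius : R := (8 * r)^-1.

Lemma branch_radius_gt0 : 0 < branch_radius.
Proof. by rewrite invr_gt0 mulr_gt0. Qed.

Lemma branch_radiusE (e : R) : `|e| <= branch_radius -> `|e| * r <= 8^-1.
Proof. by rewrite /branch_radius invfM ler_pdivlMr. Qed.

Let quarter (e : R) : `|e| <= branch_radius -> `|e| * r <= 4^-1.
Proof. by move=> /branch_radiusE; lra. Qed.

Lemma branch_solution e : `|e| <= branch_radius ->
  whitham_solution K (branch_phi e) (branch_mu e).
Proof.
by move=> /quarter er; apply: reduction_sound; exact: (fixpoint_sumE HB Hq HT er).
Qed.

Lemma branch_coef e : `|e| <= branch_radius -> coef k (branch_phi e) = e.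
Proof.
move=> /quarter er; rewrite /branch_phi coefZ (fixpoint_sumE (c := c) HB Hq HT er).
rewrite (blinD (coef_bounded k)) coefZ /cubic_map (blinB (coef_bounded k)) coefZ /B.
by rewrite !coef_resolvent mulr0 subrr mulr0 addr0 /c coef_cos// eqxx mulr1.
Qed.

Lemma branch_phi_le e : `|e| <= branch_radius -> `|branch_phi e| <= `|e| * D.
Proof.
move=> /quarter er; rewrite normrZ ler_wpM2l//.
exact: (fixpoint_sum_le HB Hq HT er).
Qed.

Lemma branch_mu_le e : `|e| <= branch_radius -> `|branch_mu e - m k| <= `|e| * (`|b| * (D * D)).
Proof.
move=> /quarter er; rewrite /branch_mu addrC addKr normrM ler_wpM2l//.
by apply: (bilin_le Hq); exact: (fixpoint_sum_le HB Hq HT er).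
Qed.

Let series_shift {V : normedModType R} (d : V) (u : nat -> V) (l : V) (e : R) :
  series (fun n => e ^+ n *: u n) @ \oo --> l ->
  series (fun n => e ^+ n *: (if n is n'.+1 then u n' else d)) @ \oo --> d + e *: l.
Proof.
move=> ul; rewrite -cvg_shiftS.
rewrite (_ : [sequence _]_n = fun n => d + e *: series (fun n => e ^+ n *: u n) n).
  by apply: cvgD; [exact: cvg_cst|exact: cvgZl_tmp].
apply/funext => n; rewrite /= !seriesEord/= big_ord_recl expr0 scale1r; congr (_ + _).
by rewrite scaler_sumr; apply: eq_bigr => i _; rewrite scalerA -exprS.
Qed.

(** Both components are power series in [e] starting at [0] and [m k]; the
    coefficients of [w] and of [q w w] appear shifted by one. *)
Lemma branch_analytic a : `|a| <= branch_radius ->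
  real_analytic_at (fun e : R => (branch_phi e, branch_mu e) : X * R) a.
Proof.
move=> /branch_radiusE ar.
have r1 : 1 <= r by exact: growth_ge1.
have shift_le (V : normedModType R) (d : V) (u : nat -> V) A :
    (forall n, `|u n| <= A * r ^+ n) ->
    forall n, `|if n is n'.+1 then u n' else d| <= (A + `|d|) * r ^+ n.
  move=> uA; have A0 : 0 <= A by have := le_trans (normr_ge0 _) (uA 0%N); rewrite mulr1.
  case=> [|n]; first by rewrite mulr1 lerDr.
  rewrite (le_trans (uA n))// ler_pM ?exprn_ge0 ?(ltW r0) ?lerDl//.
  by rewrite exprS ler_peMl// exprn_ge0// ltW.
apply: real_analytic_pair.
  apply: (power_series_analytic r0 (shift_le _ 0 _ _ (fixpoint_coef_le c HB Hq HT)) _ ar) => e er.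
  have := @series_shift _ (0 : X) _ _ _ (fixpoint_sum_cvg (c := c) HB Hq HT er).
  by rewrite add0r.
apply: (@power_series_analytic R R^o _ _ _ _ r0 (shift_le R^o (m k) _ _ (q_coef_le c HB Hq HT)) _ _ ar) => e er.
exact: (@series_shift R^o (m k) _ _ _ (q_series_cvg HB Hq HT er)).
Qed.

(** The difference quotient at [0] is [w] itself. *)
Lemma branch_derivative : derivable branch_phi 0 1 /\ 'D_1 branch_phi 0 = c.
Proof.
have h : (fun h : R => h^-1 *: (branch_phi (h *: (1 : R) + 0) - branch_phi 0)) @ 0^' --> c.
  pose L := cubic_lip b D * D.
  have L0 : 0 < L + 1 by rewrite ltr_wpDl// mulr_ge0.
  apply/cvgrPdist_le => eps eps0; near=> h.
  have h0 : h != 0 by near: h; exact: nbhs_dnbhs_neq.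
  have hs : `|h| <= Num.min branch_radius (eps / (L + 1)).
    near: h; apply: dnbhs0_le.
    by rewrite lt_min branch_radius_gt0 divr_gt0.
  move: hs; rewrite le_min => /andP[hr heps].
  have hE : h *: (1 : R) + 0 = h by rewrite addr0; exact: mulr1.
  rewrite hE /branch_phi scale0r subr0 scalerA mulVf// scale1r.
  rewrite distrC (le_trans (fixpoint_sum_near HB Hq HT (quarter hr)))//.
  rewrite -/D -/L (@le_trans _ _ (`|h| * (L + 1)))//; first by rewrite ler_wpM2l// lerDl.
  by rewrite -ler_pdivlMr.
split; first by apply/cvg_ex; exists c.
exact: (cvg_lim _ h).
Unshelve. all: by end_near. Qed.

(** The parameter of a nontrivial solution is its coefficient on the kernel;
    dividing by it gives a fixed point in the ball where fixed points are
    unique. *)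
Lemma branch_complete (delta : R) : 0 < delta ->
  exists2 rho : R, 0 < rho & forall (psi : X) nu, `|psi| < rho -> `|nu - m k| < rho ->
    whitham_solution K psi nu -> psi != 0 ->
    exists2 e : R, `|e| < delta /\ `|e| <= branch_radius &
      psi = branch_phi e /\ nu = branch_mu e.
Proof.
move=> delta0.
pose d := Num.min (Num.min delta branch_radius) (cubic_lip b D + 1)^-1.
have d0 : 0 < d by rewrite !lt_min delta0 branch_radius_gt0 invr_gt0 ltr_wpDl.
have C1 : 0 < (8 * (C + 1))^-1 by rewrite invr_gt0 mulr_gt0// ltr_wpDl.
exists (Num.min (8 * (C + 1))^-1 (d / 2)); first by rewrite lt_min C1 divr_gt0.
move=> psi nu; rewrite !lt_min => /andP[p1 p2] /andP[n1 n2] sol psi0.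
have le := small_solution_mode p1 n1 sol.
have e0 : coef k psi != 0.
  by apply: contraNneq psi0 => e0; rewrite -normr_le0; move: le; rewrite e0 normr0 mulr0.
have [wE nuE] := reduction_complete sol e0.
have ed : `|coef k psi| < d.
  apply: (@le_lt_trans _ _ (2 * `|psi|)); first exact: (coef_bounded k).2.
  by rewrite mulrC -ltr_pdivlMr.
move: ed; rewrite !lt_min => /andP[/andP[ed1 ed2] ed3].
have wW : (coef k psi)^-1 *: psi = W (coef k psi).
  apply: (fixpoint_unique HB Hq HT (D := D) _ _ _ wE).
  - rewrite normrZ normfV ler_pdivrMl ?normr_gt0// (le_trans le)//.
    by rewrite mulrC ler_wpM2l// /D mulrC ler_wpM2r// lerDl.
  - exact: (fixpoint_sum_le HB Hq HT (quarter (ltW ed2))).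
  - apply: (@le_lt_trans _ _ (`|coef k psi| * (cubic_lip b D + 1))).
      by rewrite ler_wpM2l// lerDl.
    by rewrite -ltr_pdivlMr ?ltr_wpDl// mul1r.
  - exact: (fixpoint_sumE HB Hq HT (quarter (ltW ed2))).
exists (coef k psi); first by split=> //; exact: ltW.
rewrite /branch_phi /branch_mu -wW; split=> //.
by rewrite scalerA mulfV// scale1r.
Qed.

(** Functions of period [2 pi / k] form a closed subspace preserved by products
    and by multipliers, and it contains [cos (k x)]. *)
Lemma branch_periodic e : (0 < k)%N -> `|e| <= branch_radius ->
  periodic (branch_phi e) (pi *+ 2 / k%:R).
Proof.
move=> k0 er; set tau := pi *+ 2 / k%:R.
have wp n : periodic (fixpoint_coef B q S c n : X) tau.
  apply: (@fixpoint_coef_closed _ _ B q S c (fun f : X => periodic f tau)).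
  - by move=> a x y xp yp z; rewrite !(holderDE, holderZE) xp yp.
  - by move=> z.
  - move=> z; rewrite /c !hcosE// mulrDr /tau [k%:R * (_ / _)]mulrC divfK ?pnatr_eq0 -?lt0n//.
    exact: cosD2pi.
  - move=> x y xp yp; apply: (multiplier_periodic alpha01 k0 mS) => z.
    by rewrite !hmulE xp yp.
  - by move=> x xp; exact: (multiplier_periodic alpha01 k0 mS).
move=> x; rewrite /branch_phi !holderZE; congr (_ * _).
apply/eqP; rewrite -subr_eq0 -normr_le0; apply/ler_addgt0Pl => eps eps0; rewrite addr0.
have eps20 : 0 < eps / 2 by rewrite divr_gt0.
have /cvgrPdist_le/(_ _ eps20) [N _ /(_ N (leqnn _))] :=
  fixpoint_sum_cvg (c := c) HB Hq HT (quarter er).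
set s := series _ N => /= ws.
have sp : s (x + tau) = s x.
  rewrite /s; elim: (N : nat) => [|n IH]; first by rewrite seriesEnat/= big_geq.
  by rewrite seriesSr !holderDE IH !holderZE wp.
rewrite (_ : _ - _ = (W e - s) (x + tau) - (W e - s) x); last first.
  by rewrite !holderBE sp; ring.
rewrite (le_trans (ler_normB _ _))// [leRHS]splitr lerD//.
  exact: le_trans (holder_norm_ub _ _) ws.
exact: le_trans (holder_norm_ub _ _) ws.
Qed.

(** For [k = 0] the mode [c] is the constant [1], so [c ^ 2 = c] and [S c = 0]:
    the fixed point is [c] for every [e], and the branch is [phi = e],
    [mu = 1 + e]. *)
Lemma constant_complete : k = 0%N ->
  exists2 rho : R, 0 < rho & forall (psi : X) nu, `|psi| < rho -> `|nu - 1| < rho ->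
    whitham_solution K psi nu -> psi != 0 -> psi = holder_cst alpha (nu - 1).
Proof.
move=> k0.
have lp : 0 < cubic_lip b D + 1 by rewrite ltr_wpDl.
have [|rho rho0 H] := @branch_complete (cubic_lip b D + 1)^-1; first by rewrite invr_gt0.
exists rho => // psi nu psi_lt nu_lt sol psi0.
have m0 : m k = 1 by rewrite k0 symbol0.
have [|e [e1 e2] [-> ->]] := H psi nu psi_lt _ sol psi0; first by rewrite m0.
have cc : hmul c c = c.
  by apply: holder_even_ext => x; rewrite hmulE /c k0 hcosE// mul0r cos0 mulr1.
have Gc : c = c + e *: G c.
  by rewrite /cubic_map /B /q cc resolvent_mode scaler0 subrr scaler0 addr0.
have eL : `|e| * cubic_lip b D < 1.
  apply: (@le_lt_trans _ _ (`|e| * (cubic_lip b D + 1))); first by rewrite ler_wpM2l// lerDl.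
  by rewrite -ltr_pdivlMr// mul1r.
have WE : W e = c.
  apply: (fixpoint_unique HB Hq HT (D := D) _ _ eL _ Gc).
  - exact: (fixpoint_sum_le HB Hq HT (quarter e2)).
  - by rewrite /D; have := normr_ge0 c; lra.
  - exact: (fixpoint_sumE HB Hq HT (quarter e2)).
rewrite /branch_phi /branch_mu WE /q cc m0 addrC addKr.
rewrite -[in coef k c](scale1r c) coef_hcos mulr1.
by apply: holder_even_ext => x; rewrite holderZE /c k0 hcosE// mul0r cos0 mulr1.
Qed.

End AtMode.
End Bifurcation.

(** * Bifurcation from the trivial solutions *)

Lemma nbhs_pairP {R : realType} {V : normedModType R} (p : V) (a : R) (U : set (V * R)) :
  nbhs (p, a) U <-> exists2 rho : R, 0 < rho &
    forall x y, `|x - p| < rho -> `|y - a| < rho -> U (x, y).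
Proof.
split=> [/nbhs_ballP[rho rho0 h]|[rho rho0 h]].
  exists rho => // x y xp ya; apply: h; split=> /=; rewrite -ball_normE /= distrC//.
apply/nbhs_ballP; exists rho => // -[x y] [/=].
by rewrite -!ball_normE /= => xp ya; apply: h; rewrite distrC.
Qed.

Section Conclusion.
Context {R : realType} {alpha : R} {K : R -> R}.
Hypothesis alpha01 : 0 < alpha < 1.
Hypothesis hK : is_whitham_kernel K.
Notation X := (holder_even alpha).
Local Notation m n := (@whitham_symbol R n%:R).

Lemma trivial_solution mu : whitham_solution K (0 : X) mu.
Proof.
apply/(whitham_solutionE alpha01 hK).
have := multiplier_Lw alpha01 hK => /multiplier_bounded[C _ HL].
by rewrite (blin0 HL) scaler0 subr0; apply: holder_even_ext => x; rewrite hmulE mulr0.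
Qed.

Lemma constant_solution mu : whitham_solution K (holder_cst alpha (mu - 1)) mu.
Proof.
apply/(whitham_solutionE alpha01 hK).
have := multiplier_Lw alpha01 hK => /multiplier_bounded[C _ HL].
have -> : holder_cst alpha (mu - 1) = (mu - 1) *: hcos 0.
  by apply: holder_even_ext => x; rewrite holderZE hcosE// mul0r cos0 mulr1.
rewrite (blinZ HL) Lw_cos// symbol0 scale1r.
apply: holder_even_ext => x.
by rewrite hmulE !(holderBE, holderZE) hcosE// mul0r cos0; ring.
Qed.

(** The ball is shrunk so that [mu e] stays in [(0, 1)], which contains [m k]. *)
Lemma bifurcation_curve k : (1 <= k)%N ->
    exists (delta : R) (phi : R -> X) (mu : R -> R),
      [/\ 0 < delta,
          real_analytic_on (ball 0 delta)
            (fun e : R => (phi e, mu e) : X * R),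
          (forall e : R, ball 0 delta e ->
             [/\ 0 < mu e < 1,
                 whitham_solution K (phi e) (mu e),
                 periodic (phi e) (pi *+ 2 / k%:R)
               & e != 0 -> phi e != 0]),
          phi 0 = 0 /\ mu 0 = whitham_speed k
        & derivable phi 0 1 /\
          (forall x, ('D_1 phi 0 : X) x = cos (k%:R * x))] /\
      exists2 U : set (X * R),
        nbhs (0 : X, whitham_speed k) U &
        forall (psi : X) (nu : R), U (psi, nu) -> 0 < nu < 1 ->
          whitham_solution K psi nu -> psi != 0 ->
          exists2 e : R, ball 0 delta e & psi = phi e /\ nu = mu e.
Proof.
move=> k0; have mk0 := @symbol_gt0 R k; have mk1 := @symbol_lt1 R k k0.
have [S mS] := multiplier_resolvent alpha01 hK mk0.
have [C C0 HS] := multiplier_bounded mS.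
have rad0 := @branch_radius_gt0 R alpha k C.
pose Q : R := `|C * 3 + C + 6| * ((`|@hcos R alpha k| + 1) * 2 * ((`|@hcos R alpha k| + 1) * 2)).
have Q0 : 0 <= Q by rewrite !mulr_ge0// addr_ge0.
pose g := Num.min (m k) (1 - m k).
have g0 : 0 < g by rewrite lt_min mk0 subr_gt0.
pose delta := Num.min (@branch_radius R alpha k C) (g / (Q + 1)).
have delta0 : 0 < delta by rewrite lt_min rad0 divr_gt0// ltr_wpDl.
have ballE (e : R) : ball 0 delta e <-> `|e| < delta by rewrite -ball_normE/= sub0r normrN.
have [rho rho0 H] := branch_complete alpha01 hK mS C0 HS delta0.
have rad (e : R) : ball 0 delta e -> `|e| <= @branch_radius R alpha k C.
  by move=> /ballE; rewrite lt_min => /andP[/ltW].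
exists delta, (branch_phi k S), (branch_mu k S); split; [split=> //|].
- by move=> a /rad; exact: branch_analytic.
- move=> e ed; have er := rad e ed; split.
  + have := branch_mu_le alpha01 C0 HS er; rewrite -/Q => h.
    have : `|branch_mu k S e - m k| < g.
      apply: (le_lt_trans h); rewrite (@le_lt_trans _ _ (`|e| * (Q + 1)))//.
        by rewrite ler_wpM2l// lerDl.
      by rewrite -ltr_pdivlMr ?ltr_wpDl//; move/ballE : ed; rewrite lt_min => /andP[].
    by rewrite lt_min !ltr_norml => /andP[/andP[h1 h2] /andP[h3 h4]]; apply/andP; split; lra.
  + exact: (branch_solution alpha01 hK mS C0 HS er).
  + exact: (branch_periodic alpha01 mS C0 HS k0 er).
  + apply: contra_neq => phi0; have := branch_coef alpha01 mS C0 HS er.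
    by rewrite phi0 (blin0 (coef_bounded alpha01 k)).
- rewrite /branch_phi scale0r /branch_mu mul0r addr0; split=> //.
  exact: symbolE.
- have [d1 d2] := branch_derivative alpha01 k C0 HS; split=> // x.
  by rewrite d2 hcosE.
exists [set p : X * R | `|p.1| < rho /\ `|p.2 - m k| < rho].
  apply/nbhs_pairP; exists rho => // x y; rewrite subr0 -symbolE//.
move=> psi nu [/= p1 p2] _ sol psi0.
have [e [e1 e2] he] := H psi nu p1 p2 sol psi0; exists e => //; exact/ballE.
Qed.

(** A nonresonant speed admits no small nontrivial solution; at a resonant one
    the points of the branch accumulate. *)
Lemma bifurcation_points nu : 0 < nu -> nu != 1 ->
  bifurcation_point K alpha nu <-> exists2 k : nat, (1 <= k)%N & nu = whitham_speed k.
Proof.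
move=> nu0 nu1; split=> [[_ H]|[k k0 ->]].
  apply: contrapT => nok.
  have [|rho rho0 triv] := nonresonant_trivial alpha01 hK nu0.
    case=> [|n]; first by rewrite symbol0 eq_sym.
    apply/eqP => mn; apply: nok; exists n.+1 => //.
    by rewrite -mn symbolE.
  have [|phi [mu [[/= p1 p2] sol]]] := H [set p : X * R | `|p.1| < rho /\ `|p.2 - nu| < rho].
    by apply/nbhs_pairP; exists rho => // x y; rewrite subr0.
  by rewrite (triv phi mu p1 p2 sol) eqxx.
have mk0 := @symbol_gt0 R k.
have [S mS] := multiplier_resolvent alpha01 hK mk0.
have [C C0 HS] := multiplier_bounded mS.
rewrite -symbolE//; split=> // U /nbhs_pairP[rho rho0 UP].
pose D : R := (`|@hcos R alpha k| + 1) * 2.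
have D0 : 0 <= D by rewrite mulr_ge0// addr_ge0.
pose Q : R := `|C * 3 + C + 6| * (D * D).
have Q0 : 0 <= Q by rewrite !mulr_ge0.
pose e := Num.min (@branch_radius R alpha k C) (rho / (2 * (D + Q + 1))).
have DQ : 0 < D + Q + 1 by rewrite ltr_wpDl// addr_ge0.
have e0 : 0 < e by rewrite lt_min branch_radius_gt0 divr_gt0// mulr_gt0.
have er : `|e| <= @branch_radius R alpha k C by rewrite gtr0_norm// ge_min lexx.
have es : e * (D + Q + 1) < rho.
  rewrite (@le_lt_trans _ _ (rho / 2))//.
    by rewrite -ler_pdivlMr// -mulrA -invfM ge_min lexx orbT.
  by rewrite ltr_pdivrMr// ltr_pMr// ltr1n.
exists (branch_phi k S e), (branch_mu k S e); split.
- apply: UP; rewrite ?subr0.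
    apply: (le_lt_trans (branch_phi_le alpha01 C0 HS er)); rewrite -/D gtr0_norm//.
    by apply: le_lt_trans es; rewrite ler_pM2l// -addrA lerDl addr_ge0.
  apply: (le_lt_trans (branch_mu_le alpha01 C0 HS er)); rewrite -/D -/Q gtr0_norm//.
  by apply: le_lt_trans es; rewrite ler_pM2l// [D + Q]addrC -addrA lerDl addr_ge0.
- exact: (branch_solution alpha01 hK mS C0 HS er).
- have := branch_coef alpha01 mS C0 HS er.
  apply: contra_eqN => /eqP ->; rewrite (blin0 (coef_bounded alpha01 k)).
  by rewrite lt_eqF.
Qed.

Lemma transcritical : exists2 U : set (X * R), nbhs (0 : X, 1 : R) U &
  forall (psi : X) (nu : R), U (psi, nu) ->
    (whitham_solution K psi nu <-> psi = 0 \/ psi = holder_cst alpha (nu - 1)).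
Proof.
have mk0 := @symbol_gt0 R 0%N.
have [S mS] := multiplier_resolvent alpha01 hK mk0.
have [C C0 HS] := multiplier_bounded mS.
have [rho rho0 H] := constant_complete alpha01 hK mS C0 HS erefl.
exists [set p : X * R | `|p.1| < rho /\ `|p.2 - 1| < rho].
  by apply/nbhs_pairP; exists rho => // x y; rewrite subr0.
move=> psi nu [/= p1 p2]; split=> [sol|[->|->]]; last 2 first.
- exact: trivial_solution.
- exact: constant_solution.
by have [->|psi0] := eqVneq psi 0; [left|right; exact: H].
Qed.

End Conclusion.

Theorem corollary3p2 (R : realType) (K : R -> R) (alpha : R)
    (hK : is_whitham_kernel K) (halpha : 2^-1 < alpha < 1) :
  (* (i) *)
  ((forall k : nat, (1 <= k)%N ->
    exists (delta : R) (phi : R -> holder_even alpha) (mu : R -> R),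
      [/\ 0 < delta,
          real_analytic_on (ball 0 delta)
            (fun e : R => (phi e, mu e) : holder_even alpha * R),
          (forall e : R, ball 0 delta e ->
             [/\ 0 < mu e < 1,
                 whitham_solution K (phi e) (mu e),
                 periodic (phi e) (pi *+ 2 / k%:R)
               & e != 0 -> phi e != 0]),
          phi 0 = 0 /\ mu 0 = whitham_speed k
        & derivable phi 0 1 /\
          (forall x, ('D_1 phi 0 : holder_even alpha) x = cos (k%:R * x))] /\
      exists2 U : set (holder_even alpha * R),
        nbhs (0 : holder_even alpha, whitham_speed k) U &
        forall (psi : holder_even alpha) (nu : R), U (psi, nu) -> 0 < nu < 1 ->
          whitham_solution K psi nu -> psi != 0 ->
          exists2 e : R, ball 0 delta e & psi = phi e /\ nu = mu e) /\
   (forall nu : R, 0 < nu -> nu != 1 ->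
      (bifurcation_point K alpha nu <->
       exists2 k : nat, (1 <= k)%N & nu = whitham_speed k))) /\
  (* (ii) *)
  [/\ forall mu : R, whitham_solution K (0 : holder_even alpha) mu,
      forall mu : R, whitham_solution K (holder_cst alpha (mu - 1)) mu,
      forall mu : R, holder_cst alpha (mu - 1) = 0 <-> mu = 1
    & exists2 U : set (holder_even alpha * R),
        nbhs (0 : holder_even alpha, 1 : R) U &
        forall (psi : holder_even alpha) (nu : R), U (psi, nu) ->
          (whitham_solution K psi nu <->
           psi = 0 \/ psi = holder_cst alpha (nu - 1))].
Proof.
have alpha01 : 0 < alpha < 1 by move: halpha; lra.
split; first by split; [exact: bifurcation_curve|exact: bifurcation_points].
split; [exact: trivial_solution|exact: constant_solution| |exact: transcritical].
move=> mu; split=> [/(congr1 (fun f : holder_even alpha => f 0))/= /eqP|->].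
  by rewrite subr_eq0 => /eqP.
by apply: holder_even_ext => x /=; rewrite subrr.
Qed.
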